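(* Let Assumption (S) and Assumption (D) (stated in the context) hold. In Case NE ($|\Gamma_S^N|>0$, $|\Gamma_D^N|=0$), the inf-sup constant $\gamma$ in $$\inf_{\mathbf x\in\mathbf Y}\sup_{\mathbf y\in\mathbf Y}\frac{\langle\mathcal A\mathbf x,\mathbf y\rangle}{|||\mathbf x|||\,|||\mathbf y|||}\ge\gamma>0$$ is independent of $\mu$ and $K$ for $\mathbf Y=\mathbf X/\mathbb R_D$. Similarly, in Case EN ($|\Gamma_S^N|=0$, $|\Gamma_D^N|>0$), it is independent of $\mu$ and $K$ for $\mathbf Y=\mathbf X/\mathbb R_S$.
   Context: **Geometry and parameters.** Let $d\in\{2,3\}$ and let $\Omega\subset\mathbb R^d$ consist of a Stokes subdomain $\Omega_S$ and a Darcy subdomain $\Omega_D$ sharing the interface $\Gamma=\partial\Omega_S\cap\partial\Omega_D$. Put $\Gamma_i=\partial\Omega_i\setminus\Gamma=\Gamma_i^E\cup\Gamma_i^N$ ($i=S,D$), the essential and natural boundary parts, with $\Gamma_S^E\neq\emptyset$. $\mathbf n_i$ is the unit outer normal on $\partial\Omega_i$ and $\boldsymbol\tau$ denotes an orthonormal system of tangent vectors on $\Gamma$. $\mu>0$ and $K>0$ are scalars (viscosity and hydraulic conductivity), $\alpha_{BJS}>0$ is a constant, and $\widetilde\beta_\tau=\alpha_{BJS}/\sqrt{\mu K}$, $\beta_\tau=\mu\widetilde\beta_\tau$. $(\cdot,\cdot)_T,\|\cdot\|_T$ are the $L^2$ inner product and norm on $T$, abbreviated $(\cdot,\cdot)_S,(\cdot,\cdot)_D,\|\cdot\|_S,\|\cdot\|_D$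 on $\Omega_S,\Omega_D$; $\boldsymbol\epsilon(\mathbf v)=\frac12(\nabla\mathbf v+\nabla\mathbf v^T)$. **Meshes.** $\mathcal T_h^i$ is a family of simplicial triangulations of $\Omega_i$, the two matching on $\Gamma$; $\mathcal T_h=\mathcal T_h^S\cup\mathcal T_h^D$; $h$ is the maximal element diameter; $\mathcal E_h(\cdot)$ denotes the edges (faces) lying in the indicated set and $\mathcal E_h^0(\Omega_i)$ the interior edges (faces) of $\Omega_i$; $h_e$ is the length of $e$; $\mathbf n_e$ is a unit normal to $e$ and $[\![\cdot]\!]_e$ the jump across $e$ (the trace itself on boundary edges). $\nabla_h\cdot$ is the elementwise divergence. $P_m(T)$ denotes polynomials of degree $\le m$ on $T$. **Discrete spaces and forms.** These are given by one of the following two discretizations; in both, $Q_{i,h}$ is the space of piecewise constants on $\mathcal T_h^i$. (A) $H(\mathrm{div})$-conforming: $\mathbf V_{S,h}=\mathbf V_{S,h}^l\oplus\mathbf{RT}_{S,0}$, where $\mathbf V_{S,h}^l$ is the space of continuous piecewise linear vector fields on $\mathcal T_h^S$ vanishing on $\Gamma_S^E$, and $\mathbf{RT}_{S,0}$ is the space of lowest-order Raviart–Thomas fields ($\mathbf H(\mathrm{div};\Omega_S)$, elementwise in $[P_0(T)]^d\oplus\mathbf xP_0(T)$) with vanishing normal component on $\Gamma_S^E$; write uniquely $\mathbf v_S=\mathbf v_S^l+\mathbf v_S^R$ and $\mathbf v_S^R=\sum_e v_e\boldsymbol\phi_e$ with $\boldsymbol\phi_e$ the Raviart–Thomas basis functions.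 $\mathbf V_{D,h}$ is the lowest-order Raviart–Thomas space on $\mathcal T_h^D$ with vanishing normal component on $\Gamma_D^E$. The forms are $$\begin{aligned}a_{S,h}(\mathbf u_S,\mathbf v_S)=&\,2(\boldsymbol\epsilon(\mathbf u_S^l),\boldsymbol\epsilon(\mathbf v_S^l))_S+\widetilde\beta_\tau(\mathbf u_S^l\cdot\boldsymbol\tau,\mathbf v_S^l\cdot\boldsymbol\tau)_\Gamma+2\sum_{T\in\mathcal T_h^S}\sum_{e\in\mathcal E_h(\bar\Omega_S)}\alpha_Tu_ev_e(\nabla\cdot\boldsymbol\phi_e,\nabla\cdot\boldsymbol\phi_e)_T\\&+2(\boldsymbol\epsilon(\mathbf u_S^l)\mathbf n_S\cdot\mathbf n_S,\mathbf v_S^R\cdot\mathbf n_S)_\Gamma+2(\boldsymbol\epsilon(\mathbf v_S^l)\mathbf n_S\cdot\mathbf n_S,\mathbf u_S^R\cdot\mathbf n_S)_\Gamma+\tfrac{\gamma'}{h}(\mathbf u_S^R\cdot\mathbf n_S,\mathbf v_S^R\cdot\mathbf n_S)_\Gamma,\end{aligned}$$ with positive constants $\alpha_T$ and $\gamma'$, $\gamma'$ chosen so that $a_{S,h}$ is coercive, and $a_{D,h}(\mathbf u_D,\mathbf v_D)=(\mathbf u_D,\mathbf v_D)_D$. (B) Nonconforming: $\mathbf V_{S,h}$ is the space of piecewise linear vector fields on $\mathcal T_h^S$ with $\int_e[\![\mathbf v]\!]_e\,ds=0$ for all $e\in\mathcal E_h(\Omega_S)\cup\mathcal E_h(\Gamma_S^E)$;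 $\mathbf V_{D,h}$ is the space of piecewise linear vector fields on $\mathcal T_h^D$ with $\int_e[\![\mathbf v]\!]_e\,ds=0$ for all $e\in\mathcal E_h(\Omega_D)$ and $\int_e[\![\mathbf v\cdot\mathbf n_e]\!]_e\,ds=0$ for all $e\in\mathcal E_h(\Gamma_D^E)$. The forms are $$a_{S,h}(\mathbf u_S,\mathbf v_S)=2\sum_{T\in\mathcal T_h^S}(\boldsymbol\epsilon(\mathbf u_S),\boldsymbol\epsilon(\mathbf v_S))_T+\widetilde\beta_\tau(\mathbf u_S\cdot\boldsymbol\tau,\mathbf v_S\cdot\boldsymbol\tau)_\Gamma+\sum_{e\in\mathcal E_h^0(\Omega_S)}\int_e\tfrac1{h_e}[\![\mathbf u_S]\!]_e\cdot[\![\mathbf v_S]\!]_e\,ds,$$ $$a_{D,h}(\mathbf u_D,\mathbf v_D)=(\mathbf u_D,\mathbf v_D)_D+\sum_{e\in\mathcal E_h^0(\Omega_D)}\int_e\tfrac1{h_e}[\![\mathbf u_D\cdot\mathbf n_e]\!]_e[\![\mathbf v_D\cdot\mathbf n_e]\!]_e\,ds.$$ **Coupled spaces and forms.** $$\mathbf V_h=\Big\{(\mathbf v_S,\mathbf v_D)\in\mathbf V_{S,h}\times\mathbf V_{D,h}:\ \int_e(\mathbf v_S\cdot\mathbf n_S+\mathbf v_D\cdot\mathbf n_D)=0\ \ \forall e\in\mathcal E_h(\Gamma)\Big\},\qquad Q_h=Q_{S,h}\times Q_{D,h},$$ $$a_h(\mathbf u,\mathbf v)=\mu\,a_{S,h}(\mathbf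 u_S,\mathbf v_S)+K^{-1}a_{D,h}(\mathbf u_D,\mathbf v_D),\qquad b_h(\mathbf v,q)=-(\nabla_h\cdot\mathbf v_S,q_S)_S-(\nabla_h\cdot\mathbf v_D,q_D)_D.$$ **Norms.** With fixed $\omega_S,\omega_D\ge1$, $P_{S,h}:L^2(\Omega_S)\to Q_{S,h}$ the $L^2$-projection, $\|\mathbf v_S\|_{V_{S,h}}^2=a_{S,h}(\mathbf v_S,\mathbf v_S)$ and $\|\mathbf v_D\|_{V_{D,h}}^2=a_{D,h}(\mathbf v_D,\mathbf v_D)$: $$\|\mathbf v\|_{V_h}^2=\mu\|\mathbf v_S\|_{V_{S,h}}^2+K^{-1}\|\mathbf v_D\|_{V_{D,h}}^2+\omega_S\mu\|P_{S,h}(\nabla_h\cdot\mathbf v_S)\|_S^2+\omega_DK^{-1}\|\nabla_h\cdot\mathbf v_D\|_D^2,$$ $$\|q\|_{Q_h}^2=\omega_S^{-1}\mu^{-1}\|q_S\|_S^2+\omega_D^{-1}K\|q_D\|_D^2,\qquad |||(\mathbf v,q)|||^2=\|\mathbf v\|_{V_h}^2+\|q\|_{Q_h}^2.$$ **Operator and quotient spaces.** $\mathbf X=\mathbf V_h\times Q_h$; $\langle\mathcal A(\mathbf u,p),(\mathbf v,q)\rangle=a_h(\mathbf u,\mathbf v)+b_h(\mathbf v,p)+b_h(\mathbf u,q)$. Writing $Q_{i,h}/\mathbb R$ for the zero-mean functions in $Q_{i,h}$, $$\mathbf X/\mathbb R_S=\mathbf V_h\times\big((Q_{S,h}/\mathbb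 R)\times Q_{D,h}\big),\qquad \mathbf X/\mathbb R_D=\mathbf V_h\times\big(Q_{S,h}\times(Q_{D,h}/\mathbb R)\big),$$ both endowed with $|||\cdot|||$. **Assumption (S).** There is $\gamma_S>0$ independent of $h,\mu,\beta_\tau$ with $$\sup_{\mathbf v_S\in\mathbf V_{S,h},\ \mathbf v_S|_\Gamma=0}\frac{(\nabla_h\cdot\mathbf v_S,q_S)_S}{\|\mathbf v_S\|_{V_{S,h}}}\ge\gamma_S\|q_S\|_S\quad\forall q_S\in Q_{S,h};$$ if $|\Gamma_S^N|=0$ this is only required for $q_S\in Q_{S,h}/\mathbb R$. **Assumption (D).** There is $\gamma_D>0$ independent of $h,K$ with $$\sup_{\mathbf v_D\in\mathbf V_{D,h},\ \mathbf n\cdot\mathbf v_D|_\Gamma=0}\frac{(\nabla_h\cdot\mathbf v_D,q_D)_D}{(\|\mathbf v_D\|_{V_{D,h}}^2+\|\nabla_h\cdot\mathbf v_D\|_D^2)^{1/2}}\ge\gamma_D\|q_D\|_D\quad\forall q_D\in Q_{D,h};$$ if $|\Gamma_D^N|=0$ this is only required for $q_D\in Q_{D,h}/\mathbb R$. *)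

(* Defs.v *)
From HB Require Import structures.
From mathcomp Require Import all_boot all_order all_algebra.
From mathcomp Require Import all_classical all_reals all_analysis.

Set Implicit Arguments.
Unset Strict Implicit.
Unset Printing Implicit Defensive.

Import Order.TTheory GRing.Theory Num.Theory.
Import numFieldNormedType.Exports.

Local Open Scope classical_set_scope.
Local Open Scope ring_scope.

Inductive side := Stokes | Darcy.

Section Euclid.
Variables (R : realType) (d : nat).
Local Notation V := 'rV[R]_d.

(* The library norm on matrices is the sup norm, hence [enorm]. *)
Definition dotv (u v : V) : R := \sum_j u 0 j * v 0 j.
Definition enorm (u : V) : R := Num.sqrt (dotv u u).
Definition ddot (A B : 'M[R]_d) : R := \sum_i \sum_j A i j * B i j.

Definition diam (X : set V) : R :=
  sup [set enorm (p.1 - p.2) | p in X `*` X].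

(* s-dimensional Hausdorff outer measure up to the usual normalisation
   constant; it is only used to tell null sets from non-null ones. *)
Definition hausdorff (s : nat) (X : set V) : \bar R :=
  ereal_sup [set ereal_inf
      [set (\sum_(0 <= k <oo) (diam (U k) ^+ s)%:E)%E
        | U in [set U : nat -> set V | X `<=` \bigcup_k U k /\
            forall k x y, U k x -> U k y -> enorm (x - y) <= dl]]
    | dl in [set dl : R | 0 < dl]].

Definition bdry (X : set V) : set V := closure X `\` interior X.

Definition interface_of (Om : side -> set V) : set V :=
  bdry (Om Stokes) `&` bdry (Om Darcy).

(* [Om_regular] rules out slits, so that the boundary of a subdomain is the
   boundary of the union of the closed simplices triangulating it. *)
Record geometry := Geometry {
  Om : side -> set V;
  GE : side -> set V;
  GN : side -> set V;
  Om_neq0 : forall i, Om i !=set0;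
  Om_open : forall i, open (Om i);
  Om_connected : forall i, connected (Om i);
  Om_regular : forall i, interior (closure (Om i)) = Om i;
  Om_disjoint : Om Stokes `&` Om Darcy = set0;
  GEN_cover : forall i, GE i `|` GN i = bdry (Om i) `\` interface_of Om;
  GEN_disjoint : forall i, GE i `&` GN i = set0;
  GES_neq0 : GE Stokes !=set0 }.

Definition Gam (G : geometry) : set V := interface_of (Om G).

(* Affine fields x |-> x *m A + b; the entry A k j is the partial derivative
    with respect to x_k of the j-th component. *)
Definition affine : Type := ('M[R]_d * V)%type.
Definition aval (p : affine) (x : V) : V := x *m p.1 + p.2.
Definition adiv (p : affine) : R := \tr p.1.
Definition aeps (p : affine) : 'M[R]_d := 2^-1 *: (p.1 + p.1^T).

(* refint k s f is the integral of f over {t in R^k | t >= 0, sum t <= s},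
   written as an iterated one-dimensional Lebesgue integral. *)
Fixpoint refint (k : nat) (s : R) (f : seq R -> R) : R :=
  if k is k'.+1 then
    \int[lebesgue_measure]_(t in `[0, s]) refint k' (s - t) (fun l => f (t :: l))
  else f [::].

Section Simplices.
Variables (nv : nat) (node : 'I_nv -> V).

(* A simplex is given by the set of indices of its vertices. *)
Definition hull (A : {set 'I_nv}) : set V :=
  [set x | exists c : 'I_nv -> R,
    [/\ forall j, 0 <= c j, forall j, j \notin A -> c j = 0,
        \sum_j c j = 1 & x = \sum_j c j *: node j]].

Definition relint (A : {set 'I_nv}) : set V :=
  [set x | exists c : 'I_nv -> R,
    [/\ forall j, j \in A -> 0 < c j, forall j, j \notin A -> c j = 0,
        \sum_j c j = 1 & x = \sum_j c j *: node j]].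

Definition bary (A : {set 'I_nv}) : V :=
  (#|A|%:R)^-1 *: \sum_(j in A) node j.

Definition vtx (A : {set 'I_nv}) (k : nat) : V :=
  nth 0 [seq node j | j <- enum A] k.

Definition edgemx (A : {set 'I_nv}) : 'M[R]_(#|A|.-1, d) :=
  \matrix_(k < #|A|.-1) (vtx A k.+1 - vtx A 0).

(* Integral over the simplex A of dimension #|A| - 1 with respect to its own
   volume (length, area) measure: change of variables to the reference simplex,
   with the Gram determinant as Jacobian. *)
Definition sint (A : {set 'I_nv}) (f : V -> R) : R :=
  Num.sqrt (\det (edgemx A *m (edgemx A)^T)) *
  refint #|A|.-1 1
    (fun t => f (vtx A 0 + \sum_(k < #|A|.-1) t`_k *: row k (edgemx A))).

Definition smeas (A : {set 'I_nv}) : R := sint A (fun=> 1).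

Definition is_face (nc : side -> nat)
    (cell : forall i, 'I_(nc i) -> {set 'I_nv}) (e : {set 'I_nv}) : Prop :=
  #|e| = d /\ exists i (T : 'I_(nc i)), e \subset cell i T.

End Simplices.

(* The triangulations of both subdomains share one list of nodes; conformity
   across the two sides expresses that they match on the interface. *)
Record mesh (G : geometry) := Mesh {
  nv : nat;
  node : 'I_nv -> V;
  nc : side -> nat;
  cell : forall i, 'I_(nc i) -> {set 'I_nv};
  nrm : {set 'I_nv} -> V;
  tang : {set 'I_nv} -> 'M[R]_(d.-1, d);
  cell_inj : forall i, injective (@cell i);
  cell_card : forall i (T : 'I_(nc i)), #|cell T| = d.+1;
  cell_nondeg : forall i (T : 'I_(nc i)), row_free (edgemx node (cell T));
  cell_conform : forall i j (T : 'I_(nc i)) (T' : 'I_(nc j)),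
    hull node (cell T) `&` hull node (cell T') =
    hull node (cell T :&: cell T')%SET;
  cell_cover : forall i,
    \bigcup_(T : 'I_(nc i)) hull node (cell T) = closure (Om G i);
  face_fit : forall i (T : 'I_(nc i)) (e : {set 'I_nv}),
    #|e| = d -> e \subset cell T ->
    [\/ relint node e `<=` Om G i, relint node e `<=` Gam G,
        relint node e `<=` GE G i | relint node e `<=` GN G i];
  nrm_unit : forall e, is_face cell e -> enorm (nrm e) = 1;
  nrm_orth : forall e j k, is_face cell e -> j \in e -> k \in e ->
    dotv (node j - node k) (nrm e) = 0;
  tang_on : forall e, is_face cell e -> tang e *m (tang e)^T = 1%:M;
  tang_orth : forall e, is_face cell e -> tang e *m (nrm e)^T = 0 }.

Section Mesh.
Variables (G : geometry) (M : mesh G).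

(* E_h(X): a face lies in X when its relative interior does, so that
   E_h(Om) consists of the interior faces of the (open) subdomain. *)
Definition Eh (X : set V) : {set {set 'I_(nv M)}} :=
  [set e | `[< is_face (@cell _ M) e /\ relint (@node _ M) e `<=` X >]]%SET.

Definition tint (i : side) (T : 'I_(nc M i)) (f : V -> R) : R :=
  sint (@node _ M) (cell T) f.
Definition tmeas (i : side) (T : 'I_(nc M i)) : R :=
  smeas (@node _ M) (cell T).
Definition eint (e : {set 'I_(nv M)}) (f : V -> R) : R :=
  sint (@node _ M) e f.

Definition hmax : R :=
  \big[Num.max/0]_(i <- [:: Stokes; Darcy])
    \big[Num.max/0]_(T < nc M i) diam (hull (@node _ M) (cell T)).
Definition hface (e : {set 'I_(nv M)}) : R := diam (hull (@node _ M) e).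

Definition adj (i : side) (e : {set 'I_(nv M)}) : pred 'I_(nc M i) :=
  fun T => e \subset cell T.
Arguments adj : clear implicits.

(* for e a face of the cell T: the vertex of T opposite to e *)
Definition oppv (i : side) (T : 'I_(nc M i)) (e : {set 'I_(nv M)}) : V :=
  \sum_(j in (cell T :\: e)%SET) node j.

(* signed height of T over e; its sign says whether nrm e points out of T *)
Definition height (i : side) (T : 'I_(nc M i)) (e : {set 'I_(nv M)}) : R :=
  dotv (bary (@node _ M) e - oppv T e) (nrm e).
Definition nout (i : side) (T : 'I_(nc M i)) (e : {set 'I_(nv M)}) : V :=
  Num.sg (height T e) *: nrm e.

(* A piecewise polynomial has one polynomial per cell, hence one trace per
   adjacent cell on each face. *)
Definition pwP1 (i : side) : Type := {ffun 'I_(nc M i) -> affine}.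
Definition pwP0 (i : side) : Type := {ffun 'I_(nc M i) -> R}.

Definition jump (i : side) (v : pwP1 i) (e : {set 'I_(nv M)}) (x : V) : V :=
  if #|adj i e| == 1%N then \sum_(T | adj i e T) aval (v T) x
  else \sum_(T | adj i e T) Num.sg (height T e) *: aval (v T) x.

Definition l2 (i : side) (f g : 'I_(nc M i) -> V -> R) : R :=
  \sum_T tint T (fun x => f T x * g T x).

Definition pwcst (i : side) (q : pwP0 i) : 'I_(nc M i) -> V -> R :=
  fun T _ => q T.
Definition pwdiv (i : side) (v : pwP1 i) : 'I_(nc M i) -> V -> R :=
  fun T _ => adiv (v T).

Definition l2norm (i : side) (f : 'I_(nc M i) -> V -> R) : R :=
  Num.sqrt (l2 f f).

(* the L^2-projection onto piecewise constants is the cellwise mean value *)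
Definition projQ (i : side) (f : 'I_(nc M i) -> V -> R) : pwP0 i :=
  [ffun T => tint T (f T) / tmeas T].

Definition mean0 (i : side) (q : pwP0 i) : Prop :=
  \sum_T tint T (fun=> q T) = 0.

(* f T e is an expression in the traces on e from the cell T on side i. *)
Definition gint (i : side)
    (f : forall (T : 'I_(nc M i)) (e : {set 'I_(nv M)}), V -> R) : R :=
  \sum_(e in Eh (Gam G)) \sum_(T | adj i e T) eint e (f T e).

Definition vanish_on (i : side) (v : pwP1 i) (X : set V) : Prop :=
  forall e T x, e \in Eh X -> adj i e T -> hull (@node _ M) e x ->
    aval (v T) x = 0.
Definition nvanish_on (i : side) (v : pwP1 i) (X : set V) : Prop :=
  forall e T x, e \in Eh X -> adj i e T -> hull (@node _ M) e x ->
    dotv (aval (v T) x) (nrm e) = 0.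

(* (u . tau, v . tau) on the interface, summed over the orthonormal system tau *)
Definition tang_gamma (u v : pwP1 Stokes) : R :=
  @gint Stokes (fun T e x =>
    \sum_(k < d.-1) dotv (aval (u T) x) (row k (tang e)) *
                    dotv (aval (v T) x) (row k (tang e))).

(* A discretization provides the spaces and forms on the two subdomains; an
    element of V_{S,h} is given by a parameter in [VSt], with field [fS]; the
    form a_{S,h} depends on the coefficient of the tangential term. *)
Record discretization := Discretization {
  VSt : Type;
  fS : VSt -> pwP1 Stokes;
  VS : set VSt;
  aS : R -> VSt -> VSt -> R;
  VD : set (pwP1 Darcy);
  aD : pwP1 Darcy -> pwP1 Darcy -> R }.

Definition contP1 (v : pwP1 Stokes) : Prop :=
  (forall (T T' : 'I_(nc M Stokes)) x,
      hull (@node _ M) (cell T) x -> hull (@node _ M) (cell T') x ->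
      aval (v T) x = aval (v T') x) /\
  (forall (T : 'I_(nc M Stokes)) x,
      hull (@node _ M) (cell T) x -> GE G Stokes x -> aval (v T) x = 0).

(* For piecewise polynomials, membership in H(div) is continuity of the normal
   component across the interior faces. *)
Definition RT0 (i : side) (v : pwP1 i) : Prop :=
  [/\ forall T, exists b : R, (v T).1 = b%:M,
      forall e (T T' : 'I_(nc M i)) x, e \in Eh (Om G i) ->
        adj i e T -> adj i e T' -> hull (@node _ M) e x ->
        dotv (aval (v T) x) (nrm e) = dotv (aval (v T') x) (nrm e)
    & nvanish_on v (GE G i)].

(* Restriction to T of the Raviart-Thomas basis function of the face e, with
   normal component phi_e . n_e equal to 1 on e and to 0 on the other faces. *)
Definition rtphi (i : side) (e : {set 'I_(nv M)}) (T : 'I_(nc M i)) : affine :=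
  if adj i e T then
    ((height T e)^-1%:M, - ((height T e)^-1 *: oppv T e))
  else (0, 0).

(* The coefficient v_e on phi_e: the normal component of v on e, which is
   constant on e and the same from both sides for v in RT0. *)
Definition rtdof (i : side) (v : pwP1 i) (e : {set 'I_(nv M)}) : R :=
  if [pick T | adj i e T] is Some T
  then dotv (aval (v T) (bary (@node _ M) e)) (nrm e) else 0.

(* (eps(u^l) n_S . n_S, v^R . n_S) on the interface *)
Definition cross_gamma (ul vR : pwP1 Stokes) : R :=
  @gint Stokes (fun T e x =>
    dotv (nout T e *m aeps (ul T)) (nout T e) *
    dotv (aval (vR T) x) (nout T e)).

Definition normal_gamma (uR vR : pwP1 Stokes) : R :=
  @gint Stokes (fun T e x =>
    dotv (aval (uR T) x) (nout T e) * dotv (aval (vR T) x) (nout T e)).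

Definition eps_eps (u v : pwP1 Stokes) : R :=
  \sum_(T < nc M Stokes) tint T (fun=> ddot (aeps (u T)) (aeps (v T))).

Section Hdiv.
Variables (alphaT : 'I_(nc M Stokes) -> R) (gam : R).

Definition rt_stab (uR vR : pwP1 Stokes) : R :=
  \sum_(T < nc M Stokes) \sum_(e in Eh (closure (Om G Stokes)))
    alphaT T * rtdof uR e * rtdof vR e *
    tint T (fun=> adiv (rtphi e T) * adiv (rtphi e T)).

(* An element of the direct sum V^l (+) RT0 is the pair (v^l, v^R). *)
Definition VtA : Type := (pwP1 Stokes * pwP1 Stokes)%type.

Definition aSA (bt : R) (u v : VtA) : R :=
  2 * eps_eps u.1 v.1 + bt * tang_gamma u.1 v.1 + 2 * rt_stab u.2 v.2
  + 2 * cross_gamma u.1 v.2 + 2 * cross_gamma v.1 u.2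
  + gam / hmax * normal_gamma u.2 v.2.

Definition VSA : set VtA := [set v | contP1 v.1 /\ RT0 v.2].

Definition hdiv_disc : discretization := {|
  VSt := VtA;
  fS := fun v => v.1 + v.2;
  VS := VSA;
  aS := aSA;
  VD := [set v | RT0 v];
  aD := fun u v => \sum_(T < nc M Darcy)
    tint T (fun x => dotv (aval (u T) x) (aval (v T) x)) |}.

(* Coercivity of a_{S,h} for the mesh-dependent energy norm that collects its
   sign-definite terms, uniformly in the coefficient bt of the tangential
   term, i.e. in the physical parameters. *)
Definition energyA (bt : R) (v : VtA) : R :=
  eps_eps v.1 v.1 + bt * tang_gamma v.1 v.1 + rt_stab v.2 v.2
  + hmax^-1 * normal_gamma v.2 v.2.

Definition coerciveA : Prop :=
  exists2 c : R, 0 < c & forall (bt : R) (v : VtA), 0 < bt -> VSA v ->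
    c * energyA bt v <= aSA bt v v.

End Hdiv.

Definition mean_jump0 (i : side) (v : pwP1 i) (X : set V) : Prop :=
  forall e, e \in Eh X -> forall j, eint e (fun x => jump v e x 0 j) = 0.
Definition mean_njump0 (i : side) (v : pwP1 i) (X : set V) : Prop :=
  forall e, e \in Eh X -> eint e (fun x => dotv (jump v e x) (nrm e)) = 0.

Definition nonconf_disc : discretization := {|
  VSt := pwP1 Stokes;
  fS := id;
  VS := [set v | mean_jump0 v (Om G Stokes) /\ mean_jump0 v (GE G Stokes)];
  aS := fun bt u v =>
    2 * eps_eps u v + bt * tang_gamma u v
    + \sum_(e in Eh (Om G Stokes))
        eint e (fun x => (hface e)^-1 * dotv (jump u e x) (jump v e x));
  VD := [set v | mean_jump0 v (Om G Darcy) /\ mean_njump0 v (GE G Darcy)];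
  aD := fun u v =>
    \sum_(T < nc M Darcy)
      tint T (fun x => dotv (aval (u T) x) (aval (v T) x))
    + \sum_(e in Eh (Om G Darcy))
        eint e (fun x => (hface e)^-1 *
          (dotv (jump u e x) (nrm e) * dotv (jump v e x) (nrm e))) |}.

Section Coupled.
Variable D : discretization.

Definition Vt : Type := (VSt D * pwP1 Darcy)%type.
Definition Qt : Type := (pwP0 Stokes * pwP0 Darcy)%type.
Definition Xt : Type := (Vt * Qt)%type.

Definition Vh : set Vt := [set v | [/\ VS v.1, VD D v.2 &
  forall e, e \in Eh (Gam G) ->
    \sum_(T | adj Stokes e T)
      eint e (fun x => dotv (aval (fS v.1 T) x) (nout T e)) +
    \sum_(T | adj Darcy e T)
      eint e (fun x => dotv (aval (v.2 T) x) (nout T e)) = 0]].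

Definition X_RS : set Xt := [set x | Vh x.1 /\ mean0 x.2.1].
Definition X_RD : set Xt := [set x | Vh x.1 /\ mean0 x.2.2].

Definition bh (v : Vt) (q : Qt) : R :=
  - l2 (pwdiv (fS v.1)) (pwcst q.1) - l2 (pwdiv v.2) (pwcst q.2).

Section Params.
Variables (alpha wS wD mu K : R).

Definition tbeta : R := alpha / Num.sqrt (mu * K).

Definition ah (u v : Vt) : R :=
  mu * aS tbeta u.1 v.1 + K^-1 * aD D u.2 v.2.

Definition formA (x y : Xt) : R := ah x.1 y.1 + bh y.1 x.2 + bh x.1 y.2.

Definition sqVh (v : Vt) : R :=
  mu * aS tbeta v.1 v.1 + K^-1 * aD D v.2 v.2
  + wS * mu * l2norm (pwcst (projQ (pwdiv (fS v.1)))) ^+ 2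
  + wD * K^-1 * l2norm (pwdiv v.2) ^+ 2.

Definition sqQh (q : Qt) : R :=
  wS^-1 * mu^-1 * l2norm (pwcst q.1) ^+ 2
  + wD^-1 * K * l2norm (pwcst q.2) ^+ 2.

Definition normX (x : Xt) : R := Num.sqrt (sqVh x.1 + sqQh x.2).

(* inf_x sup_y <A x, y> / (|||x||| |||y|||). The infimum is over |||x||| <> 0;
   in the supremum no exclusion is needed, as x / 0 = 0. *)
Definition infsup (Y : set Xt) : \bar R :=
  ereal_inf [set
    ereal_sup [set (formA x y / (normX x * normX y))%:E | y in Y]
    | x in [set x | Y x /\ normX x != 0]].
End Params.

(* The estimate of Assumption (S) for one pressure; ratios with denominator 0
   are 0 and do not affect the supremum. *)
Definition infsup_S (g bt : R) (q : pwP0 Stokes) : Prop :=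
  ((g * l2norm (pwcst q))%:E <=
   ereal_sup [set (l2 (pwdiv (fS v)) (pwcst q) / Num.sqrt (aS bt v v))%:E
     | v in [set v : VSt D | VS v /\ vanish_on (fS v) (Gam G)]])%E.

Definition infsup_D (g : R) (q : pwP0 Darcy) : Prop :=
  ((g * l2norm (pwcst q))%:E <=
   ereal_sup [set (l2 (pwdiv v) (pwcst q) /
                   Num.sqrt (aD D v v + l2norm (pwdiv v) ^+ 2))%:E
     | v in [set v | VD D v /\ nvanish_on v (Gam G)]])%E.

End Coupled.
End Mesh.

Section Family.
Variables (G : geometry) (I : Type) (M : I -> mesh G).

(* The parameters of the H(div) scheme are chosen before mu and K. *)
Inductive scheme :=
  | Hdiv (alphaT : forall h, 'I_(nc (M h) Stokes) -> R) (gam : R)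
  | Nonconforming.

Definition disc (s : scheme) (h : I) : discretization (M h) :=
  match s with
  | Hdiv alphaT gam => hdiv_disc (@alphaT h) gam
  | Nonconforming => nonconf_disc (M h)
  end.

Definition scheme_ok (s : scheme) : Prop :=
  match s with
  | Hdiv alphaT gam =>
      [/\ forall h T, 0 < alphaT h T, 0 < gam
        & forall h, coerciveA (@alphaT h) gam]
  | Nonconforming => True
  end.

Definition surf (X : set V) : \bar R := hausdorff d.-1 X.

Definition assumption_S (s : scheme) (alpha : R) : Prop :=
  exists2 g : R, 0 < g & forall h (mu K : R), 0 < mu -> 0 < K ->
    forall q : pwP0 (M h) Stokes,
      (surf (GN G Stokes) = 0%E -> mean0 q) ->
      infsup_S (disc s h) g (tbeta alpha mu K) q.

Definition assumption_D (s : scheme) : Prop :=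
  exists2 g : R, 0 < g & forall h (q : pwP0 (M h) Darcy),
    (surf (GN G Darcy) = 0%E -> mean0 q) -> infsup_D (disc s h) g q.

End Family.
End Euclid.

Arguments X_RS {R d G M} D.
Arguments X_RD {R d G M} D.

(* Main.v *)
Require Import Defs.
From mathcomp Require Import all_boot all_order all_algebra.
From mathcomp Require Import all_classical all_reals all_analysis.
From mathcomp Require Import ring lra.
Set Implicit Arguments.
Unset Strict Implicit.
Unset Printing Implicit Defensive.
Import Order.TTheory GRing.Theory Num.Theory.
Local Open Scope ring_scope.

(** The estimate rests on one test function. Given a velocity u and a pressure
    p = (p_S, p_D), the two one-sided assumptions provide a Stokes field and a
    Darcy field that pair with p_S and p_D to their squared norms and whose
    traces, respectively normal traces, vanish on the interface. Such fields
    satisfy the coupling condition on their own, so the two may be scaled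
    independently. With the factors 1 / (omega_S mu) and K / omega_D the combined
    field w satisfies, up to sign, b_h(w, p) = |p|^2 and a_h(w, w) <= c^2 |p|^2 in
    the weighted norm, and mu and K have cancelled ([exists_lift]). Testing with
    (u + w / c^2, - p) then gives at least (a_h(u, u) + |p|^2 / c^2) / 2, by
    expanding a_h(u + t w, u + t w) >= 0 for suitable t ([saddle_bound],
    [infsup_ge]). The test pressure is - p, so it has mean zero whenever p has.

    The velocity norm also contains the divergence. It is not produced by the
    test function, since div u_D need not have mean zero, but absorbed: on a
    given mesh |div v|^2 is bounded by the energy of v, with a constant
    independent of the coefficient of the tangential term. For the symmetric
    gradient this is the inequality between trace and Frobenius norm; for the
    Darcy forms it is an inverse estimate that follows from the spectrum of the
    mass matrix of a simplex ([sint_sqr_ge], [div_le_mass]). For the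
    Raviart-Thomas part of the H(div) scheme the stabilisation contains the
    squares of the degrees of freedom, and the divergence is their combination
    with the divergences of the basis functions ([adiv_rtdof]). There one needs
    that a degree of freedom may be computed from either adjacent cell, hence
    that a face common to two cells lies inside the subdomain; this is proved
    from the conformity of the mesh with barycentric coordinates
    ([shared_face_interior]).

    All integrands are polynomials of degree at most two. On them the iterated
    integral over a simplex equals a quadrature rule ([sint_quadrature]), from
    which come the bilinearity of the forms, the vanishing of integrals of traces
    that vanish on a face, and the mass matrix. *)

(** * Integration of quadratic functions over simplices *)

Section ReferenceIntegral.
Import numFieldNormedType.Exports.
Variable R : realType.

Lemma Rintegral_deriv_poly (p : {poly R}) (s : R) : 0 <= s ->
  (\int[lebesgue_measure]_(t in `[0%R, s]%classic) (p^`()).[t])%R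
  = p.[s] - p.[0].
Proof.
rewrite le_eqVlt => /orP[/eqP<-|s0].
  by rewrite set_itv1 Rintegral_set1 subrr.
rewrite /Rintegral (@continuous_FTC2 _ _ (horner p)) //.
- by apply: continuous_subspaceT => x; exact: continuous_horner.
- split=> [x _||].
  + exact: derivable_horner.
  + by apply: cvg_at_right_filter; exact: continuous_horner.
  + by apply: cvg_at_left_filter; exact: continuous_horner.
- by move=> x _; rewrite derivE.
Qed.

(** Integrating one variable of the reference simplex of size s leaves the
    simplex of size s - t, hence the factors (s - t) ^ m / m!. An
    antiderivative of such a factor times a polynomial in t of degree at most
    two follows by repeated integration by parts. *)
Lemma Rintegral_step (k : nat) (c0 c1 c2 b0 b1 a0 s : R) : 0 <= s ->
  (\int[lebesgue_measure]_(t in `[0%R, s]%classic)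
    ((c0 + c1 * t + c2 * t ^+ 2) * (s - t) ^+ k / (k`!)%:R
     + (b0 + b1 * t) * (s - t) ^+ k.+1 / (k.+1`!)%:R
     + a0 * (s - t) ^+ k.+2 / (k.+2`!)%:R))%R
  = c0 * s ^+ k.+1 / (k.+1`!)%:R + (c1 + b0) * s ^+ k.+2 / (k.+2`!)%:R
    + (2 * c2 + b1 + a0) * s ^+ k.+3 / (k.+3`!)%:R.
Proof.
move=> s0.
(* e m is, up to sign, an antiderivative of (s - t) ^ m / m!. *)
pose e m : {poly R} := (s%:P - 'X) ^+ m.+1 * (m.+1`!%:R^-1)%:P.
pose p : {poly R} := - (c0%:P * e k + c1%:P * ('X * e k + e k.+1)
  + c2%:P * ('X ^+ 2 * e k + 2%:P * 'X * e k.+1 + 2%:P * e k.+2)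
  + b0%:P * e k.+1 + b1%:P * ('X * e k.+1 + e k.+2) + a0%:P * e k.+2).
have de m : (e m)^`() = - ((s%:P - 'X) ^+ m * (m`!%:R^-1)%:P).
  rewrite /e derivM derivC mulr0 addr0 deriv_exp derivB derivC derivX sub0r /=.
  rewrite mulN1r mulNrn mulNr; congr (- _).
  rewrite mulrnAl -mulrnAr -mulr_natl factS natrM invfM; congr (_ * _).
  rewrite -polyC_natr -!polyCM; congr (_%:P).
  by rewrite mulrA mulfV ?mul1r // pnatr_eq0.
have eE m t : (e m).[t] = (s - t) ^+ m.+1 * m.+1`!%:R^-1.
  by rewrite /e hornerM hornerC horner_exp hornerD hornerN hornerX hornerC.
have deE m t : ((e m)^`()).[t] = - ((s - t) ^+ m * m`!%:R^-1).
  by rewrite de hornerN hornerM hornerC horner_exp hornerD hornerN hornerX hornerC.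
clearbody e.
have pE t : (p^`()).[t] =
    (c0 + c1 * t + c2 * t ^+ 2) * (s - t) ^+ k / (k`!)%:R
     + (b0 + b1 * t) * (s - t) ^+ k.+1 / (k.+1`!)%:R
     + a0 * (s - t) ^+ k.+2 / (k.+2`!)%:R.
  rewrite /p !(derivN, derivD, derivM, derivC, derivX, derivXn).
  rewrite !(hornerN, hornerD, hornerM, hornerC, hornerX, hornerXn, hornerMn).
  rewrite !deE !eE !(exprS (s - t)) /=.
  move: (_%:R^-1) (_%:R^-1) (_%:R^-1) (_%:R^-1) (_ ^+ k) => f0 f1 f2 f3 y.
  ring.
under eq_Rintegral => t _ do rewrite -pE.
rewrite Rintegral_deriv_poly // /p.
rewrite !(hornerN, hornerD, hornerM, hornerC, hornerX, hornerXn) !eE.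
rewrite subrr subr0 !(exprS 0) !mul0r.
move: (_%:R^-1) (_%:R^-1) (_%:R^-1) => f1 f2 f3; ring.
Qed.

(** With the simplex of size s as domain, the monomials 1, t_i, t_i t_j (i != j)
    and t_i ^ 2 have integrals s ^ k / k!, s ^ k.+1 / k.+1!, s ^ k.+2 / k.+2!
    and twice the latter. *)
Lemma refint_quadratic (k : nat) (c : R) (b : nat -> R) (a : nat -> nat -> R)
    (s : R) (f : seq R -> R) : 0 <= s ->
  (forall l, f l = c + \sum_(i < k) b i * l`_i
                  + \sum_(i < k) \sum_(j < k) a i j * l`_i * l`_j) ->
  refint k s f = c * s ^+ k / (k`!)%:R
    + (\sum_(i < k) b i) * s ^+ k.+1 / (k.+1`!)%:R
    + (\sum_(i < k) \sum_(j < k) a i j + \sum_(i < k) a i i)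
      * s ^+ k.+2 / (k.+2`!)%:R.
Proof.
elim: k c b a s f => [|k IH] c b a s f s0 fE.
  by rewrite /= fE !big_ord0 fact0 !addr0 !mul0r !addr0 mulr1 divr1.
rewrite [LHS]/=.
set A := \sum_(i < k.+1) \sum_(j < k.+1) a i j + _.
pose bb i t := b i.+1 + t * (a 0%N i.+1 + a i.+1 0%N).
pose A' := \sum_(i < k) \sum_(j < k) a i.+1 j.+1 + \sum_(i < k) a i.+1 i.+1.
under eq_Rintegral => t.
  rewrite inE /= in_itv /= => /andP[t0 ts].
  rewrite (IH (c + b 0%N * t + a 0%N 0%N * t ^+ 2) (bb^~ t)
             (fun i j => a i.+1 j.+1)); last 2 first.
  - by rewrite subr_ge0.
  - move=> l; rewrite fE !big_ord_recl /=.
    under [\sum_(i < k) \sum_(j < k.+1) _]eq_bigr => i _ do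
      rewrite big_ord_recl /=.
    rewrite big_split /= /bb.
    under [\sum_(i < k) (_ + _) * _]eq_bigr => i _ do rewrite mulrDl.
    rewrite big_split /=.
    rewrite (_ : \sum_(i < k) t * (a 0%N i.+1 + a i.+1 0%N) * l`_i =
      \sum_(i < k) a 0%N i.+1 * t * l`_i + \sum_(i < k) a i.+1 0%N * l`_i * t).
      ring.
    by rewrite -big_split /=; apply: eq_bigr => i _; ring.
  rewrite -/A' (_ : \sum_(i < k) bb i t = \sum_(i < k) b i.+1
    + (\sum_(i < k) (a 0%N i.+1 + a i.+1 0%N)) * t); last first.
    by rewrite big_distrl -big_split; apply: eq_bigr => i _; rewrite /bb mulrC.
  over.
rewrite Rintegral_step // /A !big_ord_recl /=.
under [\sum_(i < k) \sum_(j < k.+1) _]eq_bigr => i _ do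
  rewrite big_ord_recl /=.
rewrite !big_split /= /A'.
congr (_ + _ + _); congr (_ * _ / _).
ring.
Qed.
End ReferenceIntegral.

Section Quadrature.
Variables (R : realType) (d : nat).
Local Notation V := 'rV[R]_d.

(** Polynomials of degree at most two, recognised by their restrictions to
    parametrised affine subspaces: this is the form in which the integral over
    a simplex meets them. *)
Definition quadratic (f : V -> R) : Prop :=
  forall (k : nat) (v : V) (r : nat -> V), exists c (b : nat -> R) (a : nat -> nat -> R),
    forall l : seq R,
    f (v + \sum_(i < k) l`_i *: r i) = c + \sum_(i < k) b i * l`_i
                  + \sum_(i < k) \sum_(j < k) a i j * l`_i * l`_j.

Definition scalar_affine (f : V -> R) : Prop :=
  exists (w : V) (c : R), forall x, f x = dotv x w + c.

Lemma dotvDl (u v w : V) : dotv (u + v) w = dotv u w + dotv v w.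
Proof. by rewrite /dotv -big_split; apply: eq_bigr => i _; rewrite mxE mulrDl. Qed.

Lemma dotvC (u v : V) : dotv u v = dotv v u.
Proof. by apply: eq_bigr => i _; rewrite mulrC. Qed.

Lemma dotvZl (a : R) (u w : V) : dotv (a *: u) w = a * dotv u w.
Proof. by rewrite /dotv mulr_sumr; apply: eq_bigr => i _; rewrite mxE mulrA. Qed.

Lemma dotvZr (a : R) (u w : V) : dotv u (a *: w) = a * dotv u w.
Proof. by rewrite dotvC dotvZl dotvC. Qed.

Lemma dotv0l (w : V) : dotv 0 w = 0.
Proof. by rewrite -(scale0r 0) dotvZl mul0r. Qed.

Lemma dotv0r (w : V) : dotv w 0 = 0.
Proof. by rewrite dotvC dotv0l. Qed.

Lemma dotvNl (u w : V) : dotv (- u) w = - dotv u w.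
Proof. by rewrite -scaleN1r dotvZl mulN1r. Qed.

Lemma dotvBl (u v w : V) : dotv (u - v) w = dotv u w - dotv v w.
Proof. by rewrite dotvDl dotvNl. Qed.

Lemma dotv_suml (J : Type) (s : seq J) (P : pred J) (F : J -> V) (w : V) :
  dotv (\sum_(i <- s | P i) F i) w = \sum_(i <- s | P i) dotv (F i) w.
Proof.
elim/big_rec2: _ => [|i y1 y2 _ <-]; first exact: dotv0l.
by rewrite dotvDl.
Qed.

Lemma dotv_ge0 (u : V) : 0 <= dotv u u.
Proof. by apply: sumr_ge0 => i _; rewrite -expr2 sqr_ge0. Qed.

Lemma dotv_mulmx (u v : V) : dotv u v = (u *m v^T) 0 0.
Proof. by rewrite mxE; apply: eq_bigr => i _; rewrite mxE. Qed.

Lemma scalar_affine_param (f : V -> R) : scalar_affine f ->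
  forall (k : nat) (v : V) (r : nat -> V), exists b : nat -> R, forall l : seq R,
    f (v + \sum_(i < k) l`_i *: r i) = f v + \sum_(i < k) b i * l`_i.
Proof.
move=> [w [c fE]] k v r; exists (fun i => dotv (r i) w) => l.
rewrite !fE dotvDl dotv_suml addrAC; congr (_ + _).
by apply: eq_bigr => i _; rewrite dotvZl mulrC.
Qed.

Lemma quadratic_prod (f g : V -> R) :
  scalar_affine f -> scalar_affine g -> quadratic (fun x => f x * g x).
Proof.
move=> /scalar_affine_param hf /scalar_affine_param hg k v r.
have [b fE] := hf k v r; have [b' gE] := hg k v r.
exists (f v * g v), (fun i => f v * b' i + b i * g v), (fun i j => b i * b' j) => l.
rewrite fE gE mulrDl !mulrDr addrA.
congr (_ + _); last first.
  rewrite big_distrl; apply: eq_bigr => i _; rewrite big_distrr.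
  by apply: eq_bigr => j _ /=; ring.
rewrite -addrA; congr (_ + _).
rewrite big_distrl big_distrr -big_split.
by apply: eq_bigr => i _ /=; ring.
Qed.

Lemma quadratic_add (f g : V -> R) :
  quadratic f -> quadratic g -> quadratic (fun x => f x + g x).
Proof.
move=> hf hg k v r.
have [c [b [a fE]]] := hf k v r; have [c' [b' [a' gE]]] := hg k v r.
exists (c + c'), (fun i => b i + b' i), (fun i j => a i j + a' i j) => l.
rewrite fE gE.
under [in RHS]eq_bigr => i _ do rewrite mulrDl.
under [X in _ = _ + _ + X]eq_bigr => i _.
  under eq_bigr => j _ do rewrite !mulrDl.
  rewrite big_split /=.
  over.
rewrite !big_split /=; ring.
Qed.

Lemma scalar_affine_cst (c : R) : scalar_affine (fun=> c).
Proof. by exists 0, c => x; rewrite dotv0r add0r. Qed.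

Lemma quadratic_affine (f : V -> R) : scalar_affine f -> quadratic f.
Proof.
move=> hf; rewrite (_ : f = fun x => f x * 1); last first.
  by apply/funext => x; rewrite mulr1.
by apply: quadratic_prod => //; exact: scalar_affine_cst.
Qed.

Lemma quadratic_cst (c : R) : quadratic (fun=> c).
Proof. by apply: quadratic_affine; exact: scalar_affine_cst. Qed.

Lemma quadratic_scale (a : R) (f : V -> R) :
  quadratic f -> quadratic (fun x => a * f x).
Proof.
move=> hf k v r; have [c [b [m fE]]] := hf k v r.
exists (a * c), (fun i => a * b i), (fun i j => a * m i j) => l.
rewrite fE !mulrDr !mulr_sumr; congr (_ + _ + _); apply: eq_bigr => i _.
  by rewrite mulrA.
by rewrite mulr_sumr; apply: eq_bigr => j _; rewrite !mulrA.
Qed.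

Lemma quadratic_sum (J : Type) (s : seq J) (P : pred J) (F : J -> V -> R) :
  (forall j, quadratic (F j)) -> quadratic (fun x => \sum_(j <- s | P j) F j x).
Proof.
move=> hF; elim: s => [|j s IH].
  by under eq_fun do rewrite big_nil; exact: quadratic_cst.
under eq_fun do rewrite big_cons.
by case: (P j) => //; exact: quadratic_add (hF j) IH.
Qed.

Lemma scalar_affine_coord (p : affine R d) (j : 'I_d) :
  scalar_affine (fun x => aval p x 0 j).
Proof.
exists (col j p.1)^T, (p.2 0 j) => x.
rewrite /aval mxE dotv_mulmx trmxK !mxE; congr (_ + _).
by apply: eq_bigr => i _; rewrite !mxE.
Qed.

Lemma scalar_affine_dot (p : affine R d) (w : V) :
  scalar_affine (fun x => dotv (aval p x) w).
Proof.
exists (w *m p.1^T), (dotv p.2 w) => x.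
by rewrite /aval dotvDl !dotv_mulmx trmx_mul trmxK mulmxA.
Qed.

Section OnSimplex.
Variables (nv : nat) (node : 'I_nv -> V) (A : {set 'I_nv}).

Definition quad_weight : R :=
  Num.sqrt (\det (edgemx node A *m (edgemx node A)^T)) / (#|A|.-1.+2`!)%:R.

(** A quadrature rule on the vertices and on the midpoints of the edges; the
    weights solve the equations found for 1, t_i and t_i t_j. *)
Definition quadrature (f : V -> R) : R :=
  quad_weight * (2 * (\sum_(i in A) \sum_(j in A) f (2^-1 *: (node i + node j)))
                 - #|A|.-1%:R * \sum_(i in A) f (node i)).

Lemma sum_vtx (F : V -> R) (n : nat) : #|A| = n ->
  \sum_(i in A) F (node i) = \sum_(i < n) F (vtx node A i).
Proof.
move=> <-; rewrite -big_enum /= -(big_map node predT F) (big_nth 0) size_map.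
by rewrite -cardE big_mkord.
Qed.

(** Both sides are linear in the coefficients of f along the simplex; they agree
    on each of them. *)
Lemma sint_quadrature (f : V -> R) : (0 < #|A|)%N -> quadratic f ->
  sint node A f = quadrature f.
Proof.
move=> A0 qf; rewrite /sint /quadrature /quad_weight.
have cA : #|A| = #|A|.-1.+1 by rewrite prednK.
under [X in 2 * X]eq_bigr => i _ do
  rewrite (sum_vtx (fun y => f (2^-1 *: (node i + y))) cA).
rewrite (sum_vtx (fun x => \sum_(j < _) f (2^-1 *: (x + vtx node A j))) cA).
rewrite (sum_vtx f cA).
pose r i := vtx node A i.+1 - vtx node A 0.
have [c [b [a fE]]] := qf #|A|.-1 (vtx node A 0) r.
rewrite (refint_quadratic (c := c) (b := b) (a := a)) //; last first.
  move=> l; rewrite -fE; congr (f (_ + _)); apply: eq_bigr => i _.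
  by rewrite rowK.
move: (Num.sqrt _) => W.
have vE i : vtx node A i.+1 = vtx node A 0 + r i by rewrite /r addrC subrK.
clearbody r; move: (#|A|.-1) r fE vE => k r fE vE.
have delta (F : 'I_k -> R) (i : 'I_k) : \sum_(m < k) F m * (m == i)%:R = F i.
  rewrite (bigD1 i) //= eqxx mulr1 big1 ?addr0 // => m /negPf ->.
  by rewrite mulr0.
have fij x y (i j : 'I_k) : f (vtx node A 0 + (x *: r i + y *: r j)) =
    c + (x * b i + y * b j)
    + (x ^+ 2 * a i i + x * y * (a i j + a j i) + y ^+ 2 * a j j).
  pose l := mkseq (fun m => x * (m == i)%:R + y * (m == j)%:R) k.
  have lE (m : 'I_k) : l`_m = x * (m == i)%:R + y * (m == j)%:R.
    by rewrite nth_mkseq.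
  transitivity (f (vtx node A 0 + \sum_(m < k) l`_m *: r m)).
    congr (f (_ + _)); under eq_bigr => m _ do rewrite lE scalerDl.
    rewrite big_split /=; congr (_ + _).
      rewrite (bigD1 i) //= eqxx mulr1 big1 ?addr0 // => m /negPf.
      by rewrite -val_eqE /= => ->; rewrite mulr0 scale0r.
    rewrite (bigD1 j) //= eqxx mulr1 big1 ?addr0 // => m /negPf.
    by rewrite -val_eqE /= => ->; rewrite mulr0 scale0r.
  have sumE (F : 'I_k -> R) : \sum_(m < k) F m * l`_m = x * F i + y * F j.
    under eq_bigr => m _ do rewrite lE mulrDr !(mulrCA (F m)).
    by rewrite big_split -!mulr_sumr /= !delta.
  rewrite fE sumE; congr (_ + _).
  under eq_bigr => m _.
    under eq_bigr => m' _ do rewrite mulrAC.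
    rewrite -big_distrl /= (sumE (fun m' => a m m')).
    over.
  by rewrite (sumE (fun m => x * a m i + y * a m j)); ring.
have f0 : f (vtx node A 0) = c.
  have := fE [::]; rewrite big1 ?addr0 => [->|m _]; last by rewrite nth_nil scale0r.
  rewrite big1 ?addr0 => [|m _]; last by rewrite nth_nil mulr0.
  by rewrite big1 ?addr0 // => m _; rewrite big1 // => m' _; rewrite !nth_nil !mulr0.
have half : 2^-1 + 2^-1 = 1 :> R by lra.
have fv (i : 'I_k) : f (vtx node A i.+1) = c + b i + a i i.
  rewrite vE -[X in _ + X]addr0 -{1}(scale1r (r i)) -(scale0r (r i)) fij; lra.
have fm0 (i : 'I_k) : f (2^-1 *: (vtx node A 0 + vtx node A i.+1)) =
    c + 2^-1 * b i + 4^-1 * a i i.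
  rewrite vE addrA scalerDr scalerDr -scalerDl half scale1r -[X in _ + X]addr0.
  rewrite -(scale0r (r i)) fij; lra.
have fm : forall i j : 'I_k, f (2^-1 *: (vtx node A i.+1 + vtx node A j.+1)) =
    c + 2^-1 * (b i + b j) + 4^-1 * (a i i + (a i j + a j i) + a j j).
  move=> i j; rewrite !vE addrACA !scalerDr -scalerDl half scale1r fij; lra.
rewrite [X in 2 * X]big_ord_recl [X in 2 * (X + _)]big_ord_recl.
rewrite [X in k%:R * X]big_ord_recl.
under [X in 2 * (_ + X)]eq_bigr => i _.
  rewrite big_ord_recl lift0 addrC [_ + vtx _ _ _]addrC fm0.
  under eq_bigr => j _ do rewrite lift0 fm.
  over.
under [X in 2 * (_ + X + _)]eq_bigr => i _ do rewrite lift0 fm0.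
under [X in k%:R * (_ + X)]eq_bigr => i _ do rewrite lift0 fv.
have f00 : f (2^-1 *: (vtx node A 0 + vtx node A 0)) = c.
  by rewrite scalerDr -scalerDl half scale1r f0.
rewrite f00 f0.
set B := \sum_(i < k) b i; set S := \sum_(i < k) a i i.
set D := \sum_(i < k) \sum_(j < k) a i j.
have DC : \sum_(i < k) \sum_(j < k) a j i = D by rewrite exchange_big.
have sum1 (e x y : R) : \sum_(i < k) (e + x * b i + y * a i i)
    = k%:R * e + x * B + y * S.
  rewrite !big_split /= -!mulr_sumr; congr (_ + _ + _).
  by rewrite sumr_const card_ord mulr_natl.
have -> : \sum_(i < k) (c + b i + a i i) = k%:R * c + B + S.
  rewrite -[B]mul1r -[S]mul1r -sum1.
  by apply: eq_bigr => i _; rewrite !mul1r.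
have inner (i : 'I_k) :
    \sum_(j < k) (c + 2^-1 * (b i + b j) + 4^-1 * (a i i + (a i j + a j i) + a j j))
    = k%:R * (c + 2^-1 * b i + 4^-1 * a i i) + 2^-1 * B + 4^-1 * S
      + 4^-1 * (\sum_(j < k) a i j + \sum_(j < k) a j i).
  rewrite -(sum1 _ 2^-1 4^-1) -big_split mulr_sumr -big_split /=.
  by apply: eq_bigr => j _; lra.
under [X in 2 * (_ + X)]eq_bigr => i _ do rewrite inner.
rewrite !big_split /= -!mulr_sumr.
have sumc (e : R) : \sum_(i < k) e = k%:R * e.
  by rewrite sumr_const card_ord mulr_natl.
rewrite -/B -/S sum1 !sumc !big_split /= -/D DC.
rewrite !expr1n !factS !natrM !mulr1.
have fk : k`!%:R != 0 :> R by rewrite pnatr_eq0 -lt0n fact_gt0.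
have k1 : k.+1%:R != 0 :> R by rewrite pnatr_eq0.
have k2 : k.+2%:R != 0 :> R by rewrite pnatr_eq0.
have -> : k.+2%:R = k%:R + 2 :> R by rewrite -[k.+2]addn2 natrD.
move: fk k1 k2; rewrite -[k.+2]addn2 -[k.+1]addn1 !natrD.
move: (k%:R) (k`!%:R) => x y y0 x1 x2.
match goal with |- _ = _ * ?Q => set q := Q end.
have -> : q = (x + 2) * (x + 1) * c + (x + 2) * B + (D + S) by rewrite /q; lra.
clear -y0 x1 x2; field.
by rewrite y0 x1 x2.
Qed.
End OnSimplex.
End Quadrature.

Section SimplexIntegral.
Variables (R : realType) (d nv : nat) (node : 'I_nv -> 'rV[R]_d) (A : {set 'I_nv}).
Hypothesis A0 : (0 < #|A|)%N.
Local Notation V := 'rV[R]_d.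
Implicit Types f g : V -> R.

Lemma sint_lin (c : R) f g : quadratic f -> quadratic g ->
  sint node A (fun x => c * f x + g x) = c * sint node A f + sint node A g.
Proof.
move=> qf qg; rewrite !sint_quadrature //; last first.
  by apply: quadratic_add => //; exact: quadratic_scale.
rewrite /quadrature.
under [X in 2 * X]eq_bigr => i _ do rewrite big_split -mulr_sumr /=.
rewrite !big_split -!mulr_sumr /=; ring.
Qed.

Lemma hull_node i : i \in A -> hull node A (node i).
Proof.
move=> iA; exists (fun j => (j == i)%:R); split=> [j|j jA||].
- exact: ler0n.
- by case: eqP => // ji; rewrite ji iA in jA.
- by rewrite (bigD1 i) //= eqxx big1 ?addr0 // => j /negPf ->.
- rewrite (bigD1 i) //= eqxx scale1r big1 ?addr0 // => j /negPf ->.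
  by rewrite scale0r.
Qed.

Lemma hull_midpoint x y : hull node A x -> hull node A y ->
  hull node A (2^-1 *: (x + y)).
Proof.
move=> [a [a0 aA a1 ->]] [b [b0 bA b1 ->]].
exists (fun j => 2^-1 * (a j + b j)); split=> [j|j jA||].
- by rewrite mulr_ge0 // addr_ge0.
- by rewrite aA // bA // addr0 mulr0.
- by rewrite -mulr_sumr big_split /= a1 b1; lra.
- rewrite -big_split /= scaler_sumr; apply: eq_bigr => j _.
  by rewrite -scalerDl scalerA.
Qed.

Lemma sint_eq0 f : quadratic f -> (forall x, hull node A x -> f x = 0) ->
  sint node A f = 0.
Proof.
move=> qf f0; rewrite sint_quadrature // /quadrature.
rewrite big1 => [|i iA]; last first.
  by rewrite big1 // => j jA; apply/f0/hull_midpoint; exact: hull_node.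
rewrite big1 => [|i iA]; last by apply/f0/hull_node.
by rewrite !mulr0 subr0 mulr0.
Qed.

Lemma refint_ge0 (k : nat) (s : R) (F : seq R -> R) :
  (forall l, 0 <= F l) -> 0 <= refint k s F.
Proof.
elim: k s F => [|k IH] s F F0 //=.
by apply: Rintegral_ge0 => t _; apply: IH => l.
Qed.

Lemma sint_ge0 f : (forall x, 0 <= f x) -> 0 <= sint node A f.
Proof. by move=> f0; rewrite /sint mulr_ge0 ?sqrtr_ge0 // refint_ge0. Qed.

Lemma sint_cst (c : R) : sint node A (fun=> c) = c * smeas node A.
Proof.
have := @sint_lin c (fun=> 1) (fun=> 0) (quadratic_cst 1) (quadratic_cst 0).
rewrite mulr1 addr0 => ->.
by rewrite (@sint_eq0 (fun=> 0)) ?addr0 //; exact: quadratic_cst.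
Qed.

Lemma smeas_ge0 : 0 <= smeas node A.
Proof. by apply: sint_ge0 => x; exact: ler01. Qed.

Lemma scalar_affine_mid f x y : scalar_affine f ->
  f (2^-1 *: (x + y)) = 2^-1 * (f x + f y).
Proof. by move=> [w [c fE]]; rewrite !fE dotvZl dotvDl; lra. Qed.

(** The mass matrix of the linear shape functions on a simplex of dimension k is
    |A| / ((k + 1) (k + 2)) times the sum of the identity and of the matrix of
    ones, hence bounded below by the first of the two. *)
Lemma sint_sqr_ge f : scalar_affine f ->
  smeas node A * \sum_(i in A) f (node i) ^+ 2
  <= (#|A| * #|A|.+1)%:R * sint node A (fun x => f x * f x).
Proof.
move=> af; have sumc (e : R) : \sum_(i in A) e = #|A|%:R * e by rewrite sumr_const mulr_natl.
rewrite /smeas !sint_quadrature //; last 2 first.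
- by apply: quadratic_prod.
- exact: quadratic_cst.
rewrite /quadrature !sumc.
have : 0 <= quad_weight node A by rewrite divr_ge0 ?sqrtr_ge0 ?ler0n.
move: (quad_weight node A) => W W0.
under [X in _ <= _ * (_ * (2 * X - _))]eq_bigr => i _.
  (* The midpoint value is the mean of the vertex values. *)
  rewrite (eq_bigr (fun j => 4^-1 * f (node i) ^+ 2 + 4^-1 * f (node j) ^+ 2 +
     2^-1 * (f (node i) * f (node j)))); last first.
    by move=> j _; rewrite (scalar_affine_mid _ _ af); lra.
  rewrite !big_split /= sumc -!mulr_sumr.
  over.
rewrite !big_split /= sumc -!mulr_sumr -mulr_suml.
set S := \sum_(i in A) f (node i) ^+ 2; set T := \sum_(i in A) f (node i).
have -> : #|A|.-1%:R = #|A|%:R - 1 :> R.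
  by rewrite -[in RHS](prednK A0) -natr1 addrK.
rewrite natrM -[#|A|.+1%:R]natr1.
move: (#|A|%:R) (ler0n R #|A|) => x x0.
have : 0 <= W * (x * (x + 1) * T ^+ 2).
  by rewrite mulr_ge0 // mulr_ge0 ?sqr_ge0 // mulr_ge0 // addr_ge0.
lra.
Qed.
End SimplexIntegral.

(** * Symmetric bilinear forms given by integrals *)

Section Forms.
Variable R : realType.

Definition linform (W : lmodType R) (f : W -> R) : Prop :=
  forall c u v, f (c *: u + v) = c * f u + f v.

Definition sbilin (W : lmodType R) (a : W -> W -> R) : Prop :=
  (forall u v, a u v = a v u) /\ forall v, linform (a^~ v).

Section Closure.
Variable W : lmodType R.
Implicit Types (f g : W -> R) (a b : W -> W -> R).

Lemma linform_add f g : linform f -> linform g -> linform (fun u => f u + g u).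
Proof. by move=> hf hg c u v; rewrite hf hg; ring. Qed.

Lemma linform_scale (k : R) f : linform f -> linform (fun u => k * f u).
Proof. by move=> hf c u v; rewrite hf; ring. Qed.

Lemma linform_scaler (k : R) f : linform f -> linform (fun u => f u * k).
Proof. by move=> hf c u v; rewrite hf; ring. Qed.

Lemma linform_sum (J : Type) (s : seq J) (P : pred J) (F : J -> W -> R) :
  (forall j, P j -> linform (F j)) -> linform (fun u => \sum_(j <- s | P j) F j u).
Proof.
move=> hF c u v; rewrite mulr_sumr -big_split.
by apply: eq_bigr => j Pj; rewrite hF.
Qed.

Lemma sbilin_add a b : sbilin a -> sbilin b -> sbilin (fun u v => a u v + b u v).
Proof.
move=> [sa la] [sb lb]; split=> [u v|v]; first by rewrite sa sb.
exact: linform_add.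
Qed.

Lemma sbilin_scale (k : R) a : sbilin a -> sbilin (fun u v => k * a u v).
Proof. by move=> [sa la]; split=> [u v|v]; [rewrite sa|exact: linform_scale]. Qed.

Lemma sbilin_sum (J : Type) (s : seq J) (P : pred J) (F : J -> W -> W -> R) :
  (forall j, P j -> sbilin (F j)) ->
  sbilin (fun u v => \sum_(j <- s | P j) F j u v).
Proof.
move=> hF; split=> [u v|v].
  by apply: eq_bigr => j Pj; have [-> _] := hF j Pj.
by apply: linform_sum => j Pj; have [_ l] := hF j Pj; exact: l.
Qed.

Lemma sbilin_prod f : linform f -> sbilin (fun u v => f u * f v).
Proof.
move=> hf; split=> [u v|v]; first exact: mulrC.
exact: linform_scaler.
Qed.

Lemma sbilin_swap (c : W -> W -> R) : (forall v, linform (c^~ v)) ->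
  (forall u, linform (c u)) -> sbilin (fun u v => c u v + c v u).
Proof.
move=> hl hr; split=> [u v|v]; first exact: addrC.
exact: linform_add.
Qed.

Lemma sbilin_sqr a (t : R) u w : sbilin a ->
  a (u + t *: w) (u + t *: w) = a u u + 2 * t * a u w + t ^+ 2 * a w w.
Proof.
move=> [sa la]; rewrite addrC la !(sa _ (t *: w + u)) !la (sa w u); ring.
Qed.

Lemma sbilin_right a (t : R) u w : sbilin a ->
  a u (u + t *: w) = a u u + t * a u w.
Proof. by move=> [sa la]; rewrite sa addrC la (sa w u) addrC. Qed.

Section Integrated.
Variables (d nv : nat) (node : 'I_nv -> 'rV[R]_d) (A : {set 'I_nv}).
Hypothesis A0 : (0 < #|A|)%N.

Lemma linform_sint (q : W -> 'rV[R]_d -> R) : (forall u, quadratic (q u)) ->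
  (forall x, linform (q^~ x)) -> linform (fun u => sint node A (q u)).
Proof.
move=> qq lq c u v; rewrite -sint_lin //.
by congr (sint _ _ _); apply/funext => x; exact: lq.
Qed.

Lemma sbilin_sint (q : W -> W -> 'rV[R]_d -> R) :
  (forall u v, quadratic (q u v)) -> (forall x, sbilin (fun u v => q u v x)) ->
  sbilin (fun u v => sint node A (q u v)).
Proof.
move=> qq sq; split=> [u v|v].
  by congr (sint _ _ _); apply/funext => x; case: (sq x).
by apply: linform_sint => // x; case: (sq x).
Qed.

End Integrated.
End Closure.

Lemma sbilin_comp (W W' : lmodType R) (L : W -> W') (a : W' -> W' -> R) :
  (forall c u v, L (c *: u + v) = c *: L u + L v) -> sbilin a ->
  sbilin (fun u v => a (L u) (L v)).
Proof.
move=> lL [sa la]; split=> [u v|v]; first exact: sa.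
by move=> c u w; rewrite lL la.
Qed.

End Forms.

(** * Piecewise affine fields on a mesh *)

Section Fields.
Variables (R : realType) (d : nat).
Local Notation V := 'rV[R]_d.

Lemma aval_lin (c : R) (p q : affine R d) (x : V) :
  aval (c *: p + q : affine R d) x = c *: aval p x + aval q x.
Proof. by rewrite /aval /= mulmxDr -scalemxAr scalerDr addrACA. Qed.

Lemma adiv_lin (c : R) (p q : affine R d) :
  adiv (c *: p + q : affine R d) = c * adiv p + adiv q.
Proof. by rewrite /adiv mxtraceD mxtraceZ. Qed.

Lemma aeps_lin (c : R) (p q : affine R d) :
  aeps (c *: p + q : affine R d) = c *: aeps p + aeps q.
Proof.
apply/matrixP => i j; rewrite !mxE /=; ring.
Qed.

Variables (G : geometry R d) (M : mesh G) (i : side).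
Hypothesis d0 : (0 < d)%N.

Lemma face_card e X : e \in Eh M X -> (0 < #|e|)%N.
Proof. by rewrite inE => /asboolP[[-> _] _]. Qed.

Lemma cell_pos (T : 'I_(nc M i)) : (0 < #|cell T|)%N.
Proof. by rewrite cell_card. Qed.

Lemma pw_lin (c : R) (u v : pwP1 M i) T : (c *: u + v) T = c *: u T + v T.
Proof. by rewrite !ffunE. Qed.

Lemma tmeas_ge0 (T : 'I_(nc M i)) : 0 <= tmeas T.
Proof. exact/smeas_ge0. Qed.

Lemma tint_cst (T : 'I_(nc M i)) (c : R) : tint T (fun=> c) = c * tmeas T.
Proof. exact/sint_cst/cell_pos. Qed.

Lemma l2_cst (q r : pwP0 M i) :
  l2 (pwcst q) (pwcst r) = \sum_T q T * r T * tmeas T.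
Proof. by apply: eq_bigr => T _; rewrite /pwcst tint_cst. Qed.

Lemma l2_div_cst (v : pwP1 M i) (q : pwP0 M i) :
  l2 (pwdiv v) (pwcst q) = \sum_T adiv (v T) * q T * tmeas T.
Proof. by apply: eq_bigr => T _; rewrite /pwcst /pwdiv tint_cst. Qed.

Lemma l2norm_cst (q : pwP0 M i) :
  l2norm (pwcst q) ^+ 2 = \sum_T q T ^+ 2 * tmeas T.
Proof.
rewrite sqr_sqrtr ?l2_cst.
  by apply: eq_bigr => T _; rewrite expr2.
by apply: sumr_ge0 => T _; rewrite -expr2 mulr_ge0 ?sqr_ge0 ?tmeas_ge0.
Qed.

Lemma l2norm_div (v : pwP1 M i) :
  l2norm (pwdiv v) ^+ 2 = \sum_T adiv (v T) ^+ 2 * tmeas T.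
Proof.
have := l2norm_cst [ffun T => adiv (v T)].
rewrite (_ : pwcst _ = pwdiv v); last first.
  by apply/funext => T; apply/funext => x; rewrite /pwcst ffunE.
by move->; apply: eq_bigr => T _; rewrite ffunE.
Qed.

Lemma linform_l2_div (q : pwP0 M i) :
  linform (fun v : pwP1 M i => l2 (pwdiv v) (pwcst q)).
Proof.
move=> c u v; rewrite !l2_div_cst mulr_sumr -big_split.
by apply: eq_bigr => T _; rewrite pw_lin adiv_lin /=; ring.
Qed.

(** The divergence is already piecewise constant; the inequality, in place of an
    equality, spares the positivity of the volume of a cell. *)
Lemma l2norm_proj_div (v : pwP1 M i) :
  l2norm (pwcst (projQ (pwdiv v))) ^+ 2 <= l2norm (pwdiv v) ^+ 2.
Proof.
rewrite l2norm_cst l2norm_div; apply: ler_sum => T _.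
rewrite ffunE /pwdiv tint_cst.
have [->|m0] := eqVneq (tmeas T) 0; first by rewrite !mulr0.
by rewrite mulfK.
Qed.

End Fields.

(** * The inf-sup estimate for an abstract discretization *)

Section InfSup.
Variables (R : realType) (d : nat) (G : geometry R d) (M : mesh G).
Hypothesis d0 : (0 < d)%N.

(** A ratio close to the supremum is attained at some field; rescaling that
    field makes the pairing with the pressure exactly the squared norm. *)
Lemma rescaled_maximizer (W : lmodType R) (a : W -> W -> R) (l den : W -> R)
    (S : set W) (g n : R) :
  sbilin a -> linform l -> S 0 -> (forall c w, S w -> S (c *: w)) ->
  (forall w, S w -> a w w <= den w) -> 0 < g -> 0 <= n ->
  ((g * n)%:E <= ereal_sup [set (l w / Num.sqrt (den w))%:E | w in S])%E ->
  exists w, [/\ S w, l w = n ^+ 2 & a w w <= (2 / g) ^+ 2 * n ^+ 2].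
Proof.
move=> sa ll S0 SZ aden g0 n0 hsup.
have lZ c w : l (c *: w) = c * l w.
  have l0 : l 0 = 0 by have := ll (-1) 0 0; rewrite scaler0 addr0; lra.
  by rewrite -[c *: w]addr0 ll l0 addr0.
have aZ c w : a (c *: w) (c *: w) = c ^+ 2 * a w w.
  have a0 v : a 0 v = 0.
    by have := sa.2 v (-1) 0 0; rewrite scaler0 addr0; lra.
  have := sbilin_sqr c 0 w sa; rewrite add0r => ->.
  by rewrite !a0; lra.
move: n0; rewrite le_eqVlt => /orP[/eqP n0|n0].
  exists 0; split=> //; rewrite -n0 expr0n /=.
    by rewrite -(scale0r 0) lZ mul0r.
  by rewrite -(scale0r 0) aZ expr0n /= mul0r mulr0.
have : ((g / 2 * n)%:E < (g * n)%:E)%E by rewrite lte_fin; nra.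
move=> /lt_le_trans - /(_ _ hsup) /ereal_sup_gt [_ [v Sv <-]].
rewrite lte_fin => hv.
have gn : 0 < g / 2 * n by rewrite mulr_gt0 // divr_gt0.
have s0 : 0 < Num.sqrt (den v).
  rewrite lt_def sqrtr_ge0 andbT; apply: contraTneq hv => ->.
  by rewrite invr0 mulr0 -leNgt ltW.
have den0 : 0 < den v by rewrite -sqrtr_gt0.
move: hv; rewrite ltr_pdivlMr // => hv.
have l0 : 0 < l v by apply: lt_trans hv; exact: mulr_gt0.
exists ((n ^+ 2 / l v) *: v); split; first exact: SZ.
  by rewrite lZ mulfVK // gt_eqF.
rewrite aZ; apply: (@le_trans _ _ ((n ^+ 2 / l v) ^+ 2 * den v)).
  by rewrite ler_wpM2l ?sqr_ge0 // aden.
have hv2 : (g / 2 * n) ^+ 2 * den v <= l v ^+ 2.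
  rewrite -[X in _ * X](sqr_sqrtr (ltW den0)) -exprMn.
  by rewrite ler_pXn2r ?nnegrE ?ltW // mulr_gt0.
rewrite expr_div_n mulrAC ler_pdivrMr ?exprn_gt0 //.
rewrite (_ : _ * den v = (2 / g) ^+ 2 * n ^+ 2 * ((g / 2 * n) ^+ 2 * den v)).
  by rewrite ler_wpM2l // mulr_ge0 ?sqr_ge0.
by field; rewrite gt_eqF.
Qed.

(** The reduction of the saddle-point inf-sup condition to real numbers: U2 is
    the energy of the velocity, uw its pairing with the field realising the
    inf-sup condition for the pressure, ww the energy of that field, and P2 the
    squared norm of the pressure. *)
Lemma saddle_bound (C0 th U2 uw ww P2 X2 Y2 F : R) :
  0 <= C0 -> 0 < th -> 0 <= U2 -> 0 <= P2 -> th * ww <= P2 ->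
  0 <= U2 + 2 * (- th) * uw + (- th) ^+ 2 * ww ->
  0 <= U2 + 2 * (2 * th) * uw + (2 * th) ^+ 2 * ww ->
  0 <= U2 + 2 * th * uw + th ^+ 2 * ww ->
  0 < X2 -> X2 <= C0 * U2 + P2 ->
  U2 + 2 * th * uw + th ^+ 2 * ww + P2 <= Y2 ->
  Y2 <= C0 * (U2 + 2 * th * uw + th ^+ 2 * ww) + P2 ->
  F = U2 + th * uw + th * P2 ->
  (4 * C0 + 2 / th)^-1 <= F / (Num.sqrt X2 * Num.sqrt Y2).
Proof.
move=> C00 th0 U0 P0 wwP hm h2 hp X0 hX hYl hY ->.
have thww : th ^+ 2 * ww <= th * P2 by rewrite expr2 -mulrA ler_pM2l.
(* The hypothesis at - th bounds the cross term from above, the one at 2 th from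
   below, with a margin that keeps the squared norm Y2 positive. *)
set N := (U2 + th * P2) / 2.
have FN : N <= U2 + th * uw + th * P2 by rewrite /N; lra.
have thP0 : 0 <= th * P2 by rewrite mulr_ge0 // ltW.
have PN : P2 <= 2 / th * N.
  rewrite -mulrA mulrCA ler_pdivlMl //.
  by rewrite /N; lra.
have UN : U2 <= 2 * N by rewrite /N; lra.
set C1 := 4 * C0 + 2 / th.
have C10 : 0 < C1 by rewrite ltr_wpDl ?divr_gt0 // mulr_ge0.
have N0 : 0 <= N by rewrite /N; lra.
have XN : X2 <= C1 * N by rewrite /C1; nra.
have YN : Y2 <= C1 * N.
  have h : U2 + 2 * th * uw + th ^+ 2 * ww <= 4 * N by rewrite /N; lra.
  have := ler_wpM2l C00 h; rewrite /C1; lra.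
have Np : 0 < N.
  rewrite lt_def N0 andbT; apply: contraTneq X0 => N00.
  by rewrite -leNgt (le_trans XN) // N00 mulr0.
have Y0 : 0 < Y2.
  apply: lt_le_trans hYl; rewrite /N in Np; nra.
have sX : 0 < Num.sqrt X2 by rewrite sqrtr_gt0.
have sY : 0 < Num.sqrt Y2 by rewrite sqrtr_gt0.
rewrite ler_pdivlMr ?mulr_gt0 // ler_pdivrMl //.
apply: (@le_trans _ _ (C1 * N)); last by rewrite ler_pM2l.
rewrite -(sqr_sqrtr (ltW (mulr_gt0 C10 Np))) expr2.
by apply: ler_pM; rewrite ?sqrtr_ge0 // ler_wsqrtr.
Qed.

End InfSup.

Section StableDiscretization.
Variables (R : realType) (d : nat) (G : geometry R d) (M : mesh G).
Hypothesis d0 : (0 < d)%N.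
Variables (W : lmodType R) (fS : W -> pwP1 M Stokes) (VS : set W)
  (aS : R -> W -> W -> R) (VD : set (pwP1 M Darcy))
  (aD : pwP1 M Darcy -> pwP1 M Darcy -> R).
Let D : discretization M := Discretization fS VS aS VD aD.

Definition linear_set (U : lmodType R) (S : set U) : Prop :=
  S 0 /\ forall c u v, S u -> S v -> S (c *: u + v).

Hypothesis fS_lin : forall c u v, fS (c *: u + v) = c *: fS u + fS v.
Hypothesis VS_lin : linear_set VS.
Hypothesis VD_lin : linear_set VD.
Hypothesis aS_bilin : forall bt, sbilin (aS bt).
Hypothesis aD_bilin : sbilin aD.

(** One constant serves every coefficient of the tangential term, which is the
    only way in which mu and K enter the forms on the subdomains. *)
Variable C : R.
Hypothesis C0 : 0 <= C.
Hypothesis aS_ge0 : forall bt v, 0 < bt -> VS v -> 0 <= aS bt v v.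
Hypothesis aD_ge0 : forall v, VD v -> 0 <= aD v v.
Hypothesis aS_div : forall bt v, 0 < bt -> VS v ->
  l2norm (pwdiv (fS v)) ^+ 2 <= C * aS bt v v.
Hypothesis aD_div : forall v, VD v ->
  l2norm (pwdiv v) ^+ 2 <= C * aD v v.

Lemma linform_l2_fS (q : pwP0 M Stokes) :
  linform (fun v : W => l2 (pwdiv (fS v)) (pwcst q)).
Proof. by move=> c u v; rewrite fS_lin linform_l2_div. Qed.

Lemma linear_setZ (U : lmodType R) (S : set U) c u :
  linear_set S -> S u -> S (c *: u).
Proof. by move=> [S0 Slin] Su; rewrite -[c *: u]addr0; exact: Slin. Qed.

Lemma linear_set_vanish (X : set 'rV[R]_d) :
  linear_set [set v | VS v /\ vanish_on (fS v) X].
Proof.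
have f0 : fS 0 = 0.
  have h := fS_lin (-1) 0 0.
  by move: h; rewrite scaler0 add0r scaleN1r addNr.
split=> [|c u v [Vu u0] [Vv v0]]; split.
- by case: VS_lin.
- by move=> e T x _ _ _; rewrite f0 ffunE /aval mulmx0 addr0.
- by case: VS_lin => _; apply.
- by move=> e T x eX eT hx; rewrite fS_lin pw_lin aval_lin (u0 e) // (v0 e) // scaler0 addr0.
Qed.

Lemma linear_set_nvanish (X : set 'rV[R]_d) :
  linear_set [set v | VD v /\ nvanish_on v X].
Proof.
split=> [|c u v [Vu u0] [Vv v0]]; split.
- by case: VD_lin.
- by move=> e T x _ _ _; rewrite ffunE /aval mulmx0 addr0 dotv0l.
- by case: VD_lin => _; apply.
- by move=> e T x eX eT hx; rewrite pw_lin aval_lin dotvDl dotvZl (u0 e) // (v0 e) // mulr0 addr0.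
Qed.

Lemma exists_lift_S (g bt : R) (q : pwP0 M Stokes) : 0 < bt -> 0 < g ->
  infsup_S D g bt q -> exists w, [/\ VS w, vanish_on (fS w) (Gam G),
    l2 (pwdiv (fS w)) (pwcst q) = l2norm (pwcst q) ^+ 2
    & aS bt w w <= (2 / g) ^+ 2 * l2norm (pwcst q) ^+ 2].
Proof.
move=> bt0 g0 hq; have lV := linear_set_vanish (Gam G).
have [||w [[Vw w0] lw aw]] := @rescaled_maximizer _ W (aS bt)
  (fun v => l2 (pwdiv (fS v)) (pwcst q)) (fun v => aS bt v v)
  _ g _ (aS_bilin bt) (linform_l2_fS q) lV.1
  (fun c w => @linear_setZ _ _ c w lV) _ g0 _ hq; last by exists w.
- by [].
- exact: sqrtr_ge0.
Qed.

Lemma exists_lift_D (g : R) (q : pwP0 M Darcy) : 0 < g ->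
  infsup_D D g q -> exists w, [/\ VD w, nvanish_on w (Gam G),
    l2 (pwdiv w) (pwcst q) = l2norm (pwcst q) ^+ 2
    & aD w w <= (2 / g) ^+ 2 * l2norm (pwcst q) ^+ 2].
Proof.
move=> g0 hq; have lV := linear_set_nvanish (Gam G).
have [||w [[Vw w0] lw aw]] := @rescaled_maximizer _ (pwP1 M Darcy) aD
  (fun v => l2 (pwdiv v) (pwcst q)) (fun v => aD v v + l2norm (pwdiv v) ^+ 2)
  _ g _ aD_bilin (linform_l2_div q) lV.1
  (fun c w => @linear_setZ _ _ c w lV) _ g0 _ hq; last by exists w.
- by move=> w _; rewrite lerDl sqr_ge0.
- exact: sqrtr_ge0.
Qed.

Lemma gint_trace_eq0 (i : side) (v : pwP1 M i) e :
  e \in Eh M (Gam G) -> (forall (T : 'I_(nc M i)) x, adj e T -> hull (@node _ _ _ M) e x ->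
    dotv (aval (v T) x) (nrm e) = 0) ->
  forall T : 'I_(nc M i), adj e T -> eint e (fun x => dotv (aval (v T) x) (nout T e)) = 0.
Proof.
move=> eG v0 T eT; have e0 : (0 < #|e|)%N by exact: (face_card d0 eG).
apply: (sint_eq0 e0).
- exact/quadratic_affine/scalar_affine_dot.
- by move=> x hx; rewrite /nout dotvZr v0 ?mulr0.
Qed.

(** Fields with vanishing traces on the interface do not enter the coupling
    condition, so they may be added to the two components independently. *)
Lemma Vh_add (u : W * pwP1 M Darcy) (wS : W) (wD : pwP1 M Darcy) (t s : R) :
  @Vh _ _ _ _ D u ->
  VS wS -> vanish_on (fS wS) (Gam G) -> VD wD -> nvanish_on wD (Gam G) ->
  @Vh _ _ _ _ D (u + (t *: wS, s *: wD)).
Proof.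
move=> [VSu VDu uG] VSw wS0 VDw wD0; split=> [||e eG] /=.
- by rewrite addrC; case: VS_lin => _; apply.
- by rewrite addrC; case: VD_lin => _; apply.
apply: etrans (uG e eG); congr (_ + _); apply: eq_bigr => T eT.
- rewrite (addrC u.1) fS_lin pw_lin -[RHS]add0r.
  rewrite -(mulr0 t) -(@gint_trace_eq0 Stokes (fS wS) e eG _ T eT); last first.
    by move=> T' x eT' hx; rewrite (wS0 e) // dotv0l.
  rewrite -(sint_lin _ (face_card d0 eG));
    [|exact/quadratic_affine/scalar_affine_dot..].
  congr (sint _ _ _); apply/funext => x.
  by rewrite aval_lin dotvDl dotvZl.
- rewrite (addrC u.2) pw_lin -[RHS]add0r.
  rewrite -(mulr0 s) -(@gint_trace_eq0 Darcy wD e eG _ T eT); last first.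
    by move=> T' x eT' hx; rewrite (wD0 e).
  rewrite -(sint_lin _ (face_card d0 eG));
    [|exact/quadratic_affine/scalar_affine_dot..].
  congr (sint _ _ _); apply/funext => x.
  by rewrite aval_lin dotvDl dotvZl.
Qed.

Section Constants.
Variables (alpha wS wD mu K : R).
Hypotheses (alpha0 : 0 < alpha) (wS1 : 1 <= wS) (wD1 : 1 <= wD).
Hypotheses (mu0 : 0 < mu) (K0 : 0 < K).
Local Notation Wt := (W * pwP1 M Darcy)%type.
Local Notation a := (@ah _ _ _ _ D alpha mu K).

Lemma tbeta_gt0 : 0 < tbeta alpha mu K.
Proof. by rewrite divr_gt0 // sqrtr_gt0 mulr_gt0. Qed.

Lemma sbilin_ah : sbilin (a : Wt -> Wt -> R).
Proof.
apply: sbilin_add; apply: sbilin_scale.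
- exact: (@sbilin_comp _ Wt W fst).
- exact: (@sbilin_comp _ Wt (pwP1 M Darcy) snd).
Qed.

Lemma ah_ge0 (v : Wt) : @Vh _ _ _ _ D v -> 0 <= a v v.
Proof.
move=> [Vv1 Vv2 _]; rewrite /ah addr_ge0 // mulr_ge0 ?invr_ge0 ?(ltW mu0) ?(ltW K0) //.
  exact: aS_ge0 tbeta_gt0 Vv1.
exact: aD_ge0.
Qed.

Lemma ah_le_sqVh (v : Wt) : a v v <= @sqVh _ _ _ _ D alpha wS wD mu K v.
Proof.
rewrite /sqVh /ah -[X in _ <= X]addrA lerDl.
have wS0 := le_trans ler01 wS1; have wD0 := le_trans ler01 wD1.
by rewrite addr_ge0 // mulr_ge0 ?sqr_ge0 // mulr_ge0 ?invr_ge0 // ltW.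
Qed.

Lemma sqVh_le_ah (v : Wt) : @Vh _ _ _ _ D v ->
  @sqVh _ _ _ _ D alpha wS wD mu K v <= (1 + (wS + wD) * C) * a v v.
Proof.
move=> Vv; have [Vv1 Vv2 _] := Vv; rewrite /sqVh /ah /=.
have hS := le_trans (l2norm_proj_div (fS v.1)) (aS_div tbeta_gt0 Vv1).
have hD := aD_div Vv2.
have S0 := aS_ge0 tbeta_gt0 Vv1; have D0 := aD_ge0 Vv2.
move: hS hD S0 D0; rewrite /=.
set x := aS _ _ _; set y := aD _ _.
set p := l2norm (pwcst _) ^+ 2; set q := l2norm (pwdiv v.2) ^+ 2.
move: x y p q => x y p q hS hD S0 D0.
have iK0 : 0 < K^-1 by rewrite invr_gt0.
move: (K^-1) iK0 => k k0.
have wS0 := le_trans ler01 wS1; have wD0 := le_trans ler01 wD1.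
have m1 : wS * mu * p <= wS * mu * (C * x) by rewrite ler_wpM2l // mulr_ge0 // ltW.
have m2 : wD * k * q <= wD * k * (C * y) by rewrite ler_wpM2l // mulr_ge0 // ltW.
have m3 : 0 <= wD * C * (mu * x) by rewrite !mulr_ge0 // ltW.
have m4 : 0 <= wS * C * (k * y) by rewrite !mulr_ge0 // ltW.
lra.
Qed.

Lemma sqQh_ge0 (q : Qt M) : 0 <= sqQh wS wD mu K q.
Proof.
have wS0 := le_trans ler01 wS1; have wD0 := le_trans ler01 wD1.
by rewrite /sqQh addr_ge0 // mulr_ge0 ?sqr_ge0 // mulr_ge0 ?invr_ge0 // ltW.
Qed.

Lemma bh_lin (q : Qt M) : linform ((fun v => @bh _ _ _ _ D v q) : Wt -> R).
Proof.
move=> c u v; rewrite /bh /= fS_lin linform_l2_div linform_l2_div; ring.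
Qed.

Lemma l2norm_cstN (i : side) (q : pwP0 M i) : l2norm (pwcst (- q)) = l2norm (pwcst q).
Proof.
congr Num.sqrt; rewrite !l2_cst; apply: eq_bigr => T _.
by rewrite ffunE mulrNN.
Qed.

Lemma bhN (v : Wt) (q : Qt M) :
  @bh _ _ _ _ D v (- q) = - @bh _ _ _ _ D v q.
Proof.
have h (i : side) (z : pwP1 M i) (p : pwP0 M i) :
    l2 (pwdiv z) (pwcst (- p)) = - l2 (pwdiv z) (pwcst p).
  rewrite !l2_div_cst -sumrN; apply: eq_bigr => T _.
  by rewrite ffunE mulrN mulNr.
by rewrite /bh !h opprD.
Qed.

Lemma sqQhN (q : Qt M) : sqQh wS wD mu K (- q) = sqQh wS wD mu K q.
Proof. by rewrite /sqQh /= !l2norm_cstN. Qed.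

(** The weights of the pressure norm are those of the divergence in the velocity
    norm, inverted: a lift scaled by them pairs with the pressure to its
    squared norm, and its energy stays bounded because omega_S and omega_D are
    at least one. *)
Lemma exists_lift (gS gD : R) (q : Qt M) : 0 < gS -> 0 < gD ->
  infsup_S D gS (tbeta alpha mu K) q.1 -> infsup_D D gD q.2 ->
  exists w : Wt, [/\ forall u t, @Vh _ _ _ _ D u -> @Vh _ _ _ _ D (u + t *: w),
    @bh _ _ _ _ D w q = sqQh wS wD mu K q
    & a w w <= ((2 / gS) ^+ 2 + (2 / gD) ^+ 2) * sqQh wS wD mu K q].
Proof.
move=> gS0 gD0 hS hD.
have [w [Vw w0 lw aw]] := exists_lift_S tbeta_gt0 gS0 hS.
have [z [Vz z0 lz az]] := exists_lift_D gD0 hD.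
pose t := wS^-1 * mu^-1; pose s := wD^-1 * K.
have wS0 := lt_le_trans ltr01 wS1; have wD0 := lt_le_trans ltr01 wD1.
have t0 : 0 < t by rewrite mulr_gt0 ?invr_gt0.
have s0 : 0 < s by rewrite mulr_gt0 ?invr_gt0.
exists (- t *: w, - s *: z); split=> [u c Vu||].
- have -> : c *: ((- t *: w, - s *: z) : Wt) = (c * - t *: w, c * - s *: z).
    by congr pair; rewrite scalerA.
  exact: Vh_add.
- rewrite /bh /= -[- t *: w]addr0 -[- s *: z]addr0.
  rewrite (linform_l2_fS q.1 (- t) w 0) (linform_l2_div q.2 (- s) z 0) lw lz.
  have l0 (U : lmodType R) (l : U -> R) : linform l -> l 0 = 0.
    by move=> ll; have := ll (-1) 0 0; rewrite scaler0 addr0; lra.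
  rewrite (l0 _ _ (linform_l2_fS q.1)) (l0 _ _ (linform_l2_div q.2)) /sqQh.
  rewrite -/t -/s; ring.
- have aZ (U : lmodType R) (b : U -> U -> R) c v : sbilin b ->
    b (c *: v) (c *: v) = c ^+ 2 * b v v.
    move=> sb; have := sbilin_sqr c 0 v sb; rewrite add0r => ->.
    have b0 v' : b 0 v' = 0 by have := sb.2 v' (-1) 0 0; rewrite scaler0 addr0; lra.
    by rewrite !b0; lra.
  rewrite /ah /= (aZ _ _ _ _ (aS_bilin _)) (aZ _ _ _ _ aD_bilin) !sqrrN.
  rewrite /sqQh -/t -/s.
  have h1 : mu * (t ^+ 2 * aS (tbeta alpha mu K) w w) <=
      t * ((2 / gS) ^+ 2 * l2norm (pwcst q.1) ^+ 2).
    apply: (@le_trans _ _ (t * (wS^-1 * aS (tbeta alpha mu K) w w))).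
      by rewrite le_eqVlt; apply/orP; left; apply/eqP; rewrite /t; field; rewrite !gt_eqF.
    rewrite ler_pM2l //; apply: le_trans aw; rewrite ler_piMl //.
      exact: aS_ge0 tbeta_gt0 Vw.
    by rewrite invf_le1.
  have h2 : K^-1 * (s ^+ 2 * aD z z) <= s * ((2 / gD) ^+ 2 * l2norm (pwcst q.2) ^+ 2).
    apply: (@le_trans _ _ (s * (wD^-1 * aD z z))).
      by rewrite le_eqVlt; apply/orP; left; apply/eqP; rewrite /s; field; rewrite !gt_eqF.
    rewrite ler_pM2l //; apply: le_trans az; rewrite ler_piMl //.
      exact: aD_ge0.
    by rewrite invf_le1.
  apply: (le_trans (lerD h1 h2)).
  have p1 : 0 <= (2 / gD) ^+ 2 * (t * l2norm (pwcst q.1) ^+ 2).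
    by rewrite mulr_ge0 ?sqr_ge0 // mulr_ge0 ?sqr_ge0 // ltW.
  have p2 : 0 <= (2 / gS) ^+ 2 * (s * l2norm (pwcst q.2) ^+ 2).
    by rewrite mulr_ge0 ?sqr_ge0 // mulr_ge0 ?sqr_ge0 // ltW.
  lra.
Qed.

(** The set Y stands for either quotient space; it is closed in the way that the
    test function requires, whose pressure is the opposite of the given one. *)
Lemma infsup_ge (gS gD : R) (Y : set (Xt D)) : 0 < gS -> 0 < gD ->
  (forall x, Y x -> [/\ Vh x.1, infsup_S D gS (tbeta alpha mu K) x.2.1
                      & infsup_D D gD x.2.2]) ->
  (forall x v, Y x -> Vh v -> Y (v, - x.2)) ->
  (((4 * (1 + (wS + wD) * C) + 2 * ((2 / gS) ^+ 2 + (2 / gD) ^+ 2))^-1)%:E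
     <= infsup alpha wS wD mu K Y)%E.
Proof.
move=> gS0 gD0 hY NY; apply: le_ereal_inf_tmp => _ [x [Yx nx] <-].
have [Vx hS hD] := hY _ Yx.
have [w [Vw bw aw]] := exists_lift gS0 gD0 hS hD.
set c2 := (2 / gS) ^+ 2 + _ in aw *.
have c20 : 0 < c2 by rewrite addr_gt0 // exprn_gt0 // divr_gt0.
pose v : Wt := x.1 + c2^-1 *: w.
have Vv : @Vh _ _ _ _ D v by exact: Vw.
apply: (@le_trans _ _ (formA alpha mu K x (v, - x.2) /
  (normX alpha wS wD mu K x * normX alpha wS wD mu K ((v, - x.2) : Xt D)))%:E);
  last by apply: ereal_sup_ubound; exists (v, - x.2) => //; exact: NY.
rewrite lee_fin -[X in 2 * X]invrK /normX.
have ba := sbilin_ah.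
have av t := sbilin_sqr t x.1 w ba.
have Vt t : @Vh _ _ _ _ D (x.1 + t *: w) by exact: Vw.
have P0 := sqQh_ge0 x.2.
have ww0 (t : R) : 0 <= a x.1 x.1 + 2 * t * a x.1 w + t ^+ 2 * a w w.
  by rewrite -av; exact: ah_ge0 (Vt t).
have X0 : 0 < @sqVh _ _ _ _ D alpha wS wD mu K x.1 + sqQh wS wD mu K x.2.
  by rewrite -sqrtr_gt0 lt_def nx sqrtr_ge0.
apply: (@saddle_bound _ _ _ (a x.1 x.1) (a x.1 w) (a w w) (sqQh wS wD mu K x.2)) => //.
- have wS0 := le_trans ler01 wS1; have wD0 := le_trans ler01 wD1.
  by rewrite addr_ge0 // mulr_ge0 // addr_ge0.
- by rewrite invr_gt0.
- exact: ah_ge0.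
- by rewrite mulrC ler_pdivrMr // mulrC.
- by rewrite lerD2r sqVh_le_ah.
- by rewrite /= sqQhN lerD2r -av ah_le_sqVh.
- by rewrite /= sqQhN lerD2r -av sqVh_le_ah.
rewrite /formA /= bhN (sbilin_right _ _ _ ba) /v.
rewrite (addrC x.1) (bh_lin x.2 c2^-1 w x.1) bw; ring.
Qed.

End Constants.
End StableDiscretization.

(** * Barycentric coordinates of a cell *)

Section Barycentric.
Variables (R : realType) (d : nat) (G : geometry R d) (M : mesh G) (i : side).
Hypothesis d0 : (0 < d)%N.
Local Notation V := 'rV[R]_d.
Local Notation nd := (@node _ _ _ M).
Variable T : 'I_(nc M i).
Local Notation face j := (cell T :\ j)%SET.

Lemma card_face j : j \in cell T -> #|face j| = d.
Proof. by move=> jT; have := cardsD1 j (cell T); rewrite cell_card jT => -[]. Qed.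

Lemma face_is_face j : j \in cell T -> is_face d (@cell _ _ _ M) (face j).
Proof. by move=> jT; split; [exact: card_face|exists i, T; exact: subD1set]. Qed.

Lemma oppv_face j : j \in cell T -> oppv T (face j) = nd j.
Proof.
move=> jT; rewrite /oppv (_ : _ :\: _ = [set j])%SET ?big_set1 //.
apply/setP => k; rewrite !inE.
by case: eqVneq => [->|]; rewrite ?jT //= andNb.
Qed.

Lemma free_edges : row_free (edgemx nd (cell T))^T.
Proof.
rewrite /row_free mxrank_tr; have /eqP -> := cell_nondeg T.
by rewrite cell_card.
Qed.

Lemma affine_eq0 (p : affine R d) :
  (forall j, j \in cell T -> aval p (nd j) = 0) -> p = 0.
Proof.
move=> p0.
have vT k : (k < #|cell T|)%N -> exists2 j, j \in cell T & vtx nd (cell T) k = nd j.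
  move=> kT; have [j0 j0T] : exists j, j \in cell T.
    by apply/card_gt0P; rewrite cell_card.
  exists (nth j0 (enum (cell T)) k).
    by rewrite -mem_enum mem_nth // -cardE.
  by rewrite /vtx (nth_map j0) // -cardE.
have p1 : p.1 = 0.
  apply: trmx_inj; rewrite trmx0; apply/eqP.
  rewrite -(mulmx_free_eq0 _ free_edges) -trmx_mul -(inj_eq trmx_inj) trmxK trmx0.
  apply/eqP/row_matrixP => k; rewrite row_mul rowK row0 mulmxBl.
  have kT : (k.+1 < #|cell T|)%N by rewrite -ltn_predRL; exact: ltn_ord.
  have [j jT ->] := vT _ kT.
  have [j' jT' ->] := vT 0 (ltn_trans (ltn0Sn k) kT).
  rewrite -[_ *m _](addrK p.2) -/(aval p _) -[X in _ - X](addrK p.2) -/(aval p _).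
  by rewrite !p0 // subrr.
have [j jT] : exists j, j \in cell T by apply/card_gt0P; rewrite cell_card.
have := p0 j jT; rewrite /aval p1 mulmx0 add0r => p2.
by case: p p1 p2 {p0} => A b /= -> ->.
Qed.

Lemma dotv_face (e : {set 'I_(nv M)}) k : is_face d (@cell _ _ _ M) e -> k \in e ->
  dotv (bary nd e - nd k) (nrm e) = 0.
Proof.
move=> fe ke; rewrite dotvBl dotvZl dotv_suml.
have eqk l : l \in e -> dotv (nd l) (nrm e) = dotv (nd k) (nrm e).
  by move=> le; apply/eqP; rewrite -subr_eq0 -dotvBl nrm_orth.
rewrite (eq_bigr (fun=> dotv (nd k) (nrm e))) // sumr_const.
have e0 : (0 < #|e|)%N by apply/card_gt0P; exists k.
by rewrite -[dotv _ _ *+ _]mulr_natl mulKf ?subrr // pnatr_eq0 -lt0n.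
Qed.

Lemma height_face j : j \in cell T ->
  height T (face j) = dotv (bary nd (face j) - nd j) (nrm (face j)).
Proof. by move=> jT; rewrite /height oppv_face. Qed.

(** Otherwise the edges of the cell would all be orthogonal to a unit vector. *)
Lemma height_neq0 j : j \in cell T -> height T (face j) != 0.
Proof.
move=> jT; apply/negP => /eqP; rewrite height_face // => h0.
have fe := face_is_face jT; set n := nrm (face j) in h0.
(* p is x |-> ((x - b) . n) n with b the barycentre of the face; a zero height
   makes it vanish at the opposite vertex as well. *)
pose p : affine R d := (n^T *m n, - (dotv (bary nd (face j)) n *: n)).
have /affine_eq0 p0 : forall k, k \in cell T -> aval p (nd k) = 0.
  move=> k kT; rewrite /aval /= mulmxA.
  rewrite (mx11_scalar (nd k *m n^T)) -dotv_mulmx mul_scalar_mx -scalerBl.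
  rewrite -dotvBl -opprB dotvNl (_ : dotv _ n = 0) ?oppr0 ?scale0r //.
  have [->//|kj] := eqVneq k j; apply: dotv_face => //.
  by rewrite !inE kj.
have n1 : dotv n n = 1.
  have := nrm_unit fe; rewrite /enorm -/n => n1.
  by rewrite -(sqr_sqrtr (dotv_ge0 n)) n1 expr1n.
have : n *m (n^T *m n) = 0 by have := congr1 fst p0 => /= ->; rewrite mulmx0.
rewrite mulmxA (mx11_scalar (n *m n^T)) -dotv_mulmx n1 mul1mx => n0.
by move: n1; rewrite n0 dotv0l => /esym/eqP; rewrite oner_eq0.
Qed.

(** The gradient of the barycentric coordinate of the vertex j, expressed by the
    height over the opposite face. *)
Definition bgrad (j : 'I_(nv M)) : V :=
  - (height T (face j))^-1 *: nrm (face j).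

Definition bcoord (j : 'I_(nv M)) (x : V) : R :=
  dotv (x - bary nd (face j)) (bgrad j).

Lemma bcoord_node j k : j \in cell T -> k \in cell T ->
  bcoord j (nd k) = (j == k)%:R.
Proof.
move=> jT kT; rewrite /bcoord /bgrad dotvZr -opprB dotvNl.
have [<-|jk] := eqVneq j k.
  by rewrite -height_face // mulrNN mulVf // height_neq0.
rewrite dotv_face ?oppr0 ?mulr0 //; first exact: face_is_face.
by rewrite !inE eq_sym jk.
Qed.

Lemma bcoordE j x : bcoord j x = dotv x (bgrad j) + bcoord j 0.
Proof. by rewrite /bcoord -dotvDl addrA addr0. Qed.

(** The difference of both sides is affine and vanishes at the vertices. *)
Lemma affine_interp (p : affine R d) :
  p = (\sum_(j in cell T) (bgrad j)^T *m aval p (nd j),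
       \sum_(j in cell T) bcoord j 0 *: aval p (nd j)).
Proof.
set q : affine R d := (_, _); apply/eqP; rewrite -subr_eq0; apply/eqP.
apply: affine_eq0 => k kT.
have -> : p - q = (-1) *: q + p by rewrite scaleN1r addrC.
rewrite aval_lin scaleN1r {1}/aval /= mulmx_sumr -big_split /=.
rewrite (eq_bigr (fun j => bcoord j (nd k) *: aval p (nd j))); last first.
  move=> j jT; rewrite mulmxA (mx11_scalar (nd k *m _)) -dotv_mulmx mul_scalar_mx.
  by rewrite -scalerDl -bcoordE.
rewrite (bigD1 k) //= bcoord_node // eqxx scale1r big1 ?addr0 ?addNr //.
by move=> j /andP[jT jk]; rewrite bcoord_node // (negPf jk) scale0r.
Qed.

Lemma aval_interp (p : affine R d) x :
  aval p x = \sum_(j in cell T) bcoord j x *: aval p (nd j).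
Proof.
rewrite {1}(affine_interp p) {1}/aval /= mulmx_sumr -big_split /=.
apply: eq_bigr => j jT.
rewrite mulmxA (mx11_scalar (x *m _)) -dotv_mulmx mul_scalar_mx.
by rewrite -scalerDl -bcoordE.
Qed.

Lemma bcoord_sum x : \sum_(j in cell T) bcoord j x = 1.
Proof.
have := aval_interp (0, const_mx 1) x; rewrite /aval /= mulmx0 add0r.
under eq_bigr => j _ do rewrite mulmx0 add0r.
rewrite -scaler_suml => /matrixP /(_ 0 (Ordinal d0)); rewrite !mxE mulr1.
by move=> <-.
Qed.

Lemma bcoord_point x : x = \sum_(j in cell T) bcoord j x *: nd j.
Proof.
have := aval_interp (1%:M, 0) x; rewrite /aval /= mulmx1 addr0 => {1}->.
by apply: eq_bigr => j _; rewrite mulmx1 addr0.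
Qed.

Lemma bgrad_sum u : \sum_(j in cell T) dotv u (bgrad j) = 0.
Proof.
have := bcoord_sum u; under eq_bigr do rewrite bcoordE.
rewrite big_split /= bcoord_sum => /eqP; rewrite -subr_eq0 addrK.
by move=> /eqP.
Qed.

Lemma bgrad_point u : u = \sum_(j in cell T) dotv u (bgrad j) *: nd j.
Proof.
rewrite {1}(bcoord_point u) (eq_bigr (fun j => dotv u (bgrad j) *: nd j +
  bcoord j 0 *: nd j)); last by move=> j _; rewrite -scalerDl -bcoordE.
by rewrite big_split /= -bcoord_point addr0.
Qed.

Lemma adiv_interp (p : affine R d) :
  adiv p = \sum_(j in cell T) dotv (bgrad j) (aval p (nd j)).
Proof.
rewrite /adiv {1}(affine_interp p) /= raddf_sum; apply: eq_bigr => j _ /=.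
by rewrite mxtrace_mulC trace_mx11 dotv_mulmx -[_ *m _]trmxK mxE trmx_mul trmxK.
Qed.

Lemma hull_bcoord x : (forall j, j \in cell T -> 0 <= bcoord j x) ->
  hull nd (cell T) x.
Proof.
move=> x0; exists (fun j => if j \in cell T then bcoord j x else 0); split.
- by move=> j; case: ifPn => // /x0.
- by move=> j /negPf ->.
- by rewrite -big_mkcond /= bcoord_sum.
- rewrite {1}(bcoord_point x) big_mkcond /=; apply: eq_bigr => j _.
  by case: ifP => // _; rewrite scale0r.
Qed.

Lemma bcoord_hull_face j x : j \in cell T -> hull nd (face j) x -> bcoord j x = 0.
Proof.
move=> jT [c [_ c0 c1 ->]].
have fe := face_is_face jT.
rewrite /bcoord /bgrad dotvZr dotvBl dotv_suml.
suff -> : \sum_k dotv (c k *: nd k) (nrm (face j)) =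
          dotv (bary nd (face j)) (nrm (face j)) by rewrite subrr mulr0.
rewrite -[RHS]mul1r -c1 mulr_suml; apply: eq_bigr => k _; rewrite dotvZl.
have [ke|ke] := boolP (k \in face j); last by rewrite c0 // !mul0r.
by congr (_ * _); apply/eqP; rewrite eq_sym -subr_eq0 -dotvBl dotv_face.
Qed.

End Barycentric.

(** * Faces shared by two cells *)

Section SharedFace.
Import numFieldNormedType.Exports.
Variables (R : realType) (d : nat) (G : geometry R d) (M : mesh G) (i : side).
Hypothesis d0 : (0 < d)%N.
Local Notation V := 'rV[R]_d.
Local Notation nd := (@node _ _ _ M).

Lemma hull_subset_closure (T : 'I_(nc M i)) :
  (hull nd (cell T) `<=` closure (Om G i))%classic.
Proof. by rewrite -(cell_cover M i) => x hx; exists T. Qed.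

Lemma relint_subset_hull (A B : {set 'I_(nv M)}) : A \subset B ->
  (relint nd A `<=` hull nd B)%classic.
Proof.
move=> AB x [c [c0 cA c1 ->]]; exists c; split=> // j.
  by have [/c0/ltW//|/cA->] := boolP (j \in A).
by move=> jB; apply: cA; apply: contra jB; exact/(fintype.subsetP AB).
Qed.

Lemma face_opposite (T : 'I_(nc M i)) (e : {set 'I_(nv M)}) : #|e| = d ->
  e \subset cell T -> exists2 j, j \in cell T & e = (cell T :\ j)%SET.
Proof.
move=> ce eT; have : #|(cell T :\: e)%SET| == 1%N.
  by rewrite finset.cardsD (finset.setIidPr eT) cell_card ce subSnn.
move=> /cards1P [j jE].
have jT : j \in cell T.
  by have : j \in (cell T :\: e)%SET; [rewrite jE inE|rewrite inE => /andP[]].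
exists j => //; rewrite -jE finset.setDDr finset.setDv finset.set0U.
by apply/esym/finset.setIidPr.
Qed.

Lemma bary_relint (e : {set 'I_(nv M)}) : (0 < #|e|)%N -> relint nd e (bary nd e).
Proof.
move=> e0; exists (fun j => if j \in e then #|e|%:R^-1 else 0); split.
- by move=> j ->; rewrite invr_gt0 ltr0n.
- by move=> j /negPf ->.
- by rewrite -big_mkcond /= sumr_const -[_ *+ _]mulr_natl mulfV // pnatr_eq0 -lt0n.
- rewrite /bary scaler_sumr big_mkcond /=; apply: eq_bigr => j _.
  by case: ifP => // _; rewrite scale0r.
Qed.

Lemma bcoord_affine (T : 'I_(nc M i)) j (t : R) x y :
  bcoord T j ((1 - t) *: x + t *: y) = (1 - t) * bcoord T j x + t * bcoord T j y.
Proof.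
rewrite !(bcoordE T j (_ + _)) dotvDl !dotvZl !(bcoordE T j x) !(bcoordE T j y).
ring.
Qed.

Lemma bcoord_bary (T : 'I_(nc M i)) j k : j \in cell T -> k \in cell T ->
  bcoord T k (bary nd (cell T :\ j)%SET) = if k == j then 0 else d%:R^-1.
Proof.
move=> jT kT; case: eqVneq => [->|kj].
  by rewrite /bcoord subrr dotv0l.
rewrite bcoordE /bary dotvZl dotv_suml (card_face jT).
rewrite (eq_bigr (fun l => (k == l)%:R - bcoord T k 0)); last first.
  move=> l; rewrite !inE => /andP[_ lT].
  by rewrite -(bcoord_node kT lT) bcoordE addrK.
rewrite big_split /= sumr_const (card_face jT) (bigD1 k) ?inE ?kj ?kT //= eqxx.
rewrite big1 => [|l /andP[_ lk]]; last by rewrite eq_sym (negPf lk).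
rewrite addr0 mulrDr mulr1 mulNrn -[bcoord T k 0 *+ d]mulr_natl mulrN.
by rewrite mulKf ?subrK // pnatr_eq0 -lt0n.
Qed.

(** If the two vertices opposite to a common face lay on the same side of it, a
    segment from the barycentre of the face towards one of them would start
    inside both cells, against conformity. *)
Lemma opposite_heights (T T' : 'I_(nc M i)) (e : {set 'I_(nv M)}) : #|e| = d ->
  e \subset cell T -> e \subset cell T' -> T != T' ->
  height T e * height T' e < 0.
Proof.
move=> ce eT eT' TT'.
have [j jT ej] := face_opposite ce eT; have [j' jT' ej'] := face_opposite ce eT'.
have h0 : height T e != 0 by rewrite ej; exact: height_neq0.
have h0' : height T' e != 0 by rewrite ej'; exact: height_neq0.
rewrite ltNge le_eqVlt; apply/negP => /orP[/eqP/esym/eqP|hpos].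
  by rewrite mulf_eq0 (negPf h0) (negPf h0').
have eI : (cell T :&: cell T')%SET = e.
  apply/esym/eqP; rewrite eqEcard finset.subsetI eT eT' /= ce -ltnS.
  rewrite -(cell_card T) proper_card // fintype.properE finset.subsetIl /=.
  apply: contra TT' => TI; apply/eqP/(cell_inj (m := M)).
  apply/eqP; rewrite eqEcard !cell_card leqnn andbT.
  exact: (fintype.subset_trans TI (finset.subsetIr _ _)).
pose L k := bcoord T' k (nd j).
pose S := \sum_(k in cell T') `|L k|.
have S0 : 0 <= S by apply: sumr_ge0.
pose D : R := 1 + d%:R * S.
have D0 : 0 < D by rewrite ltr_wpDr ?mulr_ge0 ?ler0n.
have dp : 0 < d%:R :> R by rewrite ltr0n.
(* This t makes (1 - t) / d dominate t |L k| for every k, so that the point x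
   below has nonnegative coordinates in T' too. *)
pose t := D^-1; have t0 : 0 < t by rewrite invr_gt0.
have t1 : t <= 1 by rewrite invf_le1 // lerDl mulr_ge0 ?ler0n.
pose x := (1 - t) *: bary nd e + t *: nd j.
have xT : hull nd (cell T) x.
  apply: hull_bcoord => // k kT; rewrite bcoord_affine bcoord_node // ej bcoord_bary //.
  rewrite addr_ge0 // mulr_ge0 ?ler0n ?subr_ge0 // ?(ltW t0) //.
  by case: ifP => // _; rewrite invr_ge0 ler0n.
have xT' : hull nd (cell T') x.
  apply: hull_bcoord => // k kT; rewrite bcoord_affine ej' bcoord_bary //.
  case: eqVneq => [->|kj].
    rewrite mulr0 add0r mulr_ge0 ?(ltW t0) // /bcoord /bgrad dotvZr -ej'.
    rewrite -opprB dotvNl mulrNN.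
    have -> : dotv (bary nd e - nd j) (nrm e) = height T e by rewrite ej height_face.
    rewrite (_ : _ * _ = (height T e * height T' e) / (height T' e) ^+ 2).
      by rewrite divr_ge0 ?sqr_ge0 // ltW.
    by field.
  have Lk : `|L k| <= S by rewrite /S (bigD1 k) //= lerDl sumr_ge0.
  have := ler_norm (- L k); rewrite normrN => LN.
  have tD : t * D = 1 by rewrite mulVf // gt_eqF.
  have e1 : (1 - t) / d%:R = t * S.
    apply: (@mulIf _ d%:R); first by rewrite gt_eqF.
    by rewrite mulfVK ?gt_eqF // -{1}tD /D; ring.
  rewrite -/(L k) e1 -mulrDr mulr_ge0 ?(ltW t0) //; lra.
have : (hull nd (cell T) `&` hull nd (cell T'))%classic x by [].
rewrite cell_conform eI ej => /(bcoord_hull_face jT).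
rewrite bcoord_affine bcoord_node // eqxx ej bcoord_bary // eqxx mulr0 add0r mulr1.
by move=> t00; rewrite t00 ltxx in t0.
Qed.

Lemma bcoord_gt0_near (T : 'I_(nc M i)) j x : 0 < bcoord T j x ->
  (\forall y \near x, 0 < bcoord T j y)%classic.
Proof.
move=> j0.
have cj : (bcoord T j y @[y --> x] --> bcoord T j x)%classic.
  rewrite (_ : bcoord T j = fun y : V => \sum_k y 0 k * bgrad T j 0 k
                 + bcoord T j 0); last by apply/funext => y; rewrite bcoordE.
  apply: (@cvgD _ _ _ (nbhs x)); last exact: cvg_cst.
  apply: (@cvg_big _ _ _ _ _ _ _ (nbhs x)) => [|k _]; first exact: add_continuous.
  apply: (@cvgM _ _ (nbhs x)); last exact: cvg_cst.
  exact: coord_continuous.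
exact: cvgr_gt cj _ j0.
Qed.

(** Around its barycentre, a face common to two cells is covered by them: near
    that point all barycentric coordinates are positive except the two that
    vanish on the face, and these have opposite signs. *)
Lemma shared_face_interior (T T' : 'I_(nc M i)) (e : {set 'I_(nv M)}) : #|e| = d ->
  e \subset cell T -> e \subset cell T' -> T != T' -> e \in Eh M (Om G i).
Proof.
move=> ce eT eT' TT'; rewrite inE; apply/asboolP; split.
  by split=> //; exists i, T.
have [j jT ej] := face_opposite ce eT; have [j' jT' ej'] := face_opposite ce eT'.
have hh := opposite_heights ce eT eT' TT'.
pose m := bary nd e.
have dp : 0 < d%:R^-1 :> R by rewrite invr_gt0 ltr0n.
have near_pos (T1 : 'I_(nc M i)) j1 : j1 \in cell T1 -> e = (cell T1 :\ j1)%SET ->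
    (\forall y \near m, forall k, k \in e -> 0 < bcoord T1 k y)%classic.
  move=> j1T e1;
  apply: (@filter_forall _ _ (fun k y => k \in e -> 0 < bcoord T1 k y) (nbhs m)) => k.
  have [ke|ke] := boolP (k \in e); last by apply: nearW => y.
  apply: filterS (@bcoord_gt0_near T1 k m _) => [y //|].
  move: ke; rewrite /m e1 !inE => /andP[kj kT].
  by rewrite bcoord_bary // (negPf kj).
have mi : (closure (Om G i))^°%classic m.
  rewrite /interior /=.
  near=> y.
  have y0 : forall k, k \in e -> 0 < bcoord T k y by near: y; exact: near_pos jT ej.
  have y0' : forall k, k \in e -> 0 < bcoord T' k y by near: y; exact: near_pos jT' ej'.
  have in_cell (T1 : 'I_(nc M i)) j1 : e = (cell T1 :\ j1)%SET ->
      (forall k, k \in e -> 0 < bcoord T1 k y) -> 0 <= bcoord T1 j1 y ->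
      closure (Om G i) y.
    move=> e1 pos pos1; apply: (@hull_subset_closure T1); apply: hull_bcoord => // k kT.
    by have [->//|kj] := eqVneq k j1; rewrite ltW // pos // e1 !inE kj.
  have [hT|hT] := leP 0 (bcoord T j y); first exact: in_cell ej y0 hT.
  apply: (in_cell T' j' ej' y0'); move: hT.
  rewrite /bcoord /bgrad -ej -ej' !dotvZr !mulNr oppr_lt0 => hT.
  rewrite oppr_ge0 -(pmulr_rle0 _ hT).
  set x := dotv _ _; rewrite (_ : _ * _ = x ^+ 2 * (height T e * height T' e)^-1).
    by rewrite mulr_ge0_le0 ?sqr_ge0 // invr_le0 ltW.
  by rewrite invfM; ring.
have mOm : Om G i m by rewrite -(Om_regular G i).
have mr : relint nd e m by apply: bary_relint; rewrite ce.
have notbdry (X : set V) : (relint nd e `<=` X)%classic ->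
    (X `<=` bdry (Om G i))%classic -> False.
  move=> eX Xb; have [_] := Xb _ (eX _ mr); apply.
  by have := @Om_open _ _ G i; rewrite openE; exact.
have GamE : (Gam G `<=` bdry (Om G i))%classic.
  by rewrite /Gam /interface_of; case: (i) => x [].
have GEN : (GE G i `|` GN G i `<=` bdry (Om G i))%classic.
  by rewrite GEN_cover => x [].
have [//|h|h|h] := face_fit ce eT; exfalso.
- exact: notbdry h GamE.
- by apply: notbdry h _ => x hx; apply: GEN; left.
- by apply: notbdry h _ => x hx; apply: GEN; right.
Unshelve. all: by end_near.
Qed.

End SharedFace.

(** * Control of the divergence on a cell *)

Section Inequalities.
Variable R : realType.

Lemma sum_cauchy_schwarz (J : finType) (P : pred J) (x y : J -> R) :
  (\sum_(j | P j) x j * y j) ^+ 2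
  <= (\sum_(j | P j) x j ^+ 2) * (\sum_(j | P j) y j ^+ 2).
Proof.
set a := \sum_(j | P j) x j ^+ 2; set b := \sum_(j | P j) x j * y j.
set c := \sum_(j | P j) y j ^+ 2.
have c0 : 0 <= c by apply: sumr_ge0 => j _; exact: sqr_ge0.
(* Lagrange's identity: the sum below is c (a c - b ^ 2). *)
have : 0 <= \sum_(j | P j) (c * x j - b * y j) ^+ 2.
  by apply: sumr_ge0 => j _; exact: sqr_ge0.
rewrite (eq_bigr (fun j => c ^+ 2 * x j ^+ 2 - 2 * b * c * (x j * y j)
  + b ^+ 2 * y j ^+ 2)); last by move=> j _; ring.
rewrite !big_split /= sumrN -!mulr_sumr -/a -/b -/c => h.
move: c0; rewrite le_eqVlt => /orP[/eqP c0|c0]; last first.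
  by rewrite -subr_ge0 -(pmulr_rge0 _ c0); lra.
suff -> : b = 0 by rewrite -c0 mulr0 expr0n.
apply: big1 => j Pj; have /eqP := c0; rewrite eq_sym psumr_eq0.
  by move=> /allP /(_ j (mem_index_enum j)); rewrite Pj sqrf_eq0 => /eqP ->; rewrite mulr0.
by move=> k _; exact: sqr_ge0.
Qed.

Lemma sqr_sum_le (J : finType) (P : pred J) (x : J -> R) :
  (\sum_(j | P j) x j) ^+ 2 <= #|P|%:R * \sum_(j | P j) x j ^+ 2.
Proof.
have := sum_cauchy_schwarz P x (fun=> 1).
under eq_bigr do rewrite mulr1.
under [X in _ <= _ * X]eq_bigr do rewrite expr1n.
by rewrite sumr_const mulrC.
Qed.

Lemma dotv_cauchy_schwarz d (u v : 'rV[R]_d) :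
  dotv u v ^+ 2 <= dotv u u * dotv v v.
Proof.
have := sum_cauchy_schwarz xpredT (fun j => u 0 j) (fun j => v 0 j).
by rewrite /dotv; under [X in _ <= X * _]eq_bigr do rewrite expr2;
  under [X in _ <= _ * X]eq_bigr do rewrite expr2.
Qed.

Lemma adiv_sqr_aeps d (p : affine R d) :
  adiv p ^+ 2 <= d%:R * ddot (aeps p) (aeps p).
Proof.
have -> : adiv p = \sum_j aeps p j j.
  by apply: eq_bigr => j _; rewrite !mxE; lra.
apply: (le_trans (sqr_sum_le _ _)).
rewrite (_ : #|_| = d); last by rewrite -[RHS]card_ord; exact: eq_card.
rewrite ler_wpM2l ?ler0n // ler_sum // => j _.
rewrite (bigD1 j) //= -expr2 lerDl sumr_ge0 // => k _.
by rewrite -expr2 sqr_ge0.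
Qed.

Lemma ddot_ge0 d (A : 'M[R]_d) : 0 <= ddot A A.
Proof. by apply: sumr_ge0 => i _; apply: sumr_ge0 => j _; rewrite -expr2 sqr_ge0. Qed.

Lemma sint_sum d nv (node : 'I_nv -> 'rV[R]_d) (A : {set 'I_nv}) (J : Type)
    (s : seq J) (P : pred J) (F : J -> 'rV[R]_d -> R) : (0 < #|A|)%N ->
  (forall j, quadratic (F j)) ->
  sint node A (fun x => \sum_(j <- s | P j) F j x) = \sum_(j <- s | P j) sint node A (F j).
Proof.
move=> A0 qF; elim: s => [|j s IH].
  rewrite big_nil; under [X in sint _ _ X]eq_fun do rewrite big_nil.
  by rewrite sint_cst // mul0r.
rewrite big_cons; under [X in sint _ _ X]eq_fun do rewrite big_cons.
case: (P j) => //; rewrite -IH -[X in _ = X + _]mul1r -sint_lin //.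
- by congr (sint _ _ _); apply/funext => x; rewrite mul1r.
- exact: quadratic_sum.
Qed.

End Inequalities.

Section CellBounds.
Variables (R : realType) (d : nat) (G : geometry R d) (M : mesh G) (i : side).
Hypothesis d0 : (0 < d)%N.
Local Notation V := 'rV[R]_d.
Local Notation nd := (@node _ _ _ M).
Variable T : 'I_(nc M i).

Lemma quadratic_dotv (p q : affine R d) : quadratic (fun x => dotv (aval p x) (aval q x)).
Proof.
by apply: quadratic_sum => j; apply: quadratic_prod; exact: scalar_affine_coord.
Qed.

Lemma tint_dotv_ge (p : affine R d) :
  tmeas T * \sum_(j in cell T) dotv (aval p (nd j)) (aval p (nd j))
  <= (d.+1 * d.+2)%:R * tint T (fun x => dotv (aval p x) (aval p x)).
Proof.
rewrite exchange_big /= mulr_sumr /tint /dotv sint_sum; last 2 first.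
- exact: cell_pos.
- by move=> l; apply: quadratic_prod; exact: scalar_affine_coord.
rewrite mulr_sumr; apply: ler_sum => l _.
have := sint_sqr_ge nd (cell_pos T) (scalar_affine_coord p l).
by rewrite cell_card; under [X in _ * X <= _ -> _]eq_bigr do rewrite expr2.
Qed.

(** The divergence is a combination of the vertex values, and these are
    controlled by the mass matrix of the cell. *)
Lemma div_le_mass : exists2 C : R, 0 <= C & forall p : affine R d,
  adiv p ^+ 2 * tmeas T <= C * tint T (fun x => dotv (aval p x) (aval p x)).
Proof.
pose g := \sum_(j in cell T) dotv (bgrad T j) (bgrad T j).
have g0 : 0 <= g by apply: sumr_ge0 => j _; exact: dotv_ge0.
exists (d.+1%:R * g * (d.+1 * d.+2)%:R) => [|p].
  by rewrite !mulr_ge0 ?ler0n.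
rewrite -[X in _ <= X]mulrA.
apply: (@le_trans _ _ (d.+1%:R * g * (tmeas T *
   \sum_(j in cell T) dotv (aval p (nd j)) (aval p (nd j))))); last first.
  by rewrite ler_wpM2l ?tint_dotv_ge // mulr_ge0 ?ler0n.
rewrite (mulrC (tmeas T)) [X in _ <= X]mulrA ler_wpM2r ?tmeas_ge0 //.
rewrite (adiv_interp T p); apply: (le_trans (sqr_sum_le _ _)).
rewrite cell_card -mulrA ler_wpM2l ?ler0n // mulr_sumr ler_sum // => j jT.
apply: (le_trans (dotv_cauchy_schwarz _ _)); rewrite ler_wpM2r ?dotv_ge0 //.
by rewrite /g (bigD1 j) //= lerDl sumr_ge0 // => k _; exact: dotv_ge0.
Qed.

(** A field vanishes if its normal components vanish at every vertex on all
    faces through that vertex: d of the normals determine a vector, since the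
    gradients of the barycentric coordinates sum to zero and the coordinates
    reproduce vectors. *)
Lemma affine_eq0_normal (w : affine R d) :
  (forall j k, j \in cell T -> k \in cell T -> k != j ->
    dotv (aval w (nd k)) (nrm (cell T :\ j)%SET) = 0) -> w = 0.
Proof.
move=> w0; apply: (affine_eq0 (T := T)) => k kT.
have wj j : j \in cell T -> k != j -> dotv (aval w (nd k)) (bgrad T j) = 0.
  by move=> jT kj; rewrite /bgrad dotvZr w0 // mulr0.
rewrite (bgrad_point T (aval w (nd k))) big1 // => j jT.
have [jk|kj] := eqVneq k j; last by rewrite wj // scale0r.
have := bgrad_sum d0 T (aval w (nd k)); rewrite (bigD1 k) //=.
rewrite big1 ?addr0 => [|l /andP[lT lk]]; last by rewrite wj // eq_sym.
by rewrite -jk => ->; rewrite scale0r.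
Qed.

Lemma aval_rtphi j x : j \in cell T ->
  aval (rtphi (cell T :\ j)%SET T) x
  = (height T (cell T :\ j)%SET)^-1 *: (x - nd j).
Proof.
move=> jT; rewrite /rtphi /adj subD1set /aval /= oppv_face // mul_mx_scalar.
by rewrite -scalerBr.
Qed.

(** Both sides have the same normal component on every face of the cell, because
    the normal component of either is constant there. *)
Lemma RT_interp (p : affine R d) (b : R) : p.1 = b%:M ->
  p = \sum_(j in cell T)
    dotv (aval p (bary nd (cell T :\ j)%SET)) (nrm (cell T :\ j)%SET)
    *: rtphi (cell T :\ j)%SET T.
Proof.
move=> pb; pose dof j :=
  dotv (aval p (bary nd (cell T :\ j)%SET)) (nrm (cell T :\ j)%SET).
pose q : affine R d := \sum_(j in cell T) dof j *: rtphi (cell T :\ j)%SET T.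
rewrite -[RHS]/q; apply/eqP; rewrite -subr_eq0; apply/eqP.
have -> : p - q = (-1) *: q + p by rewrite scaleN1r addrC.
apply: affine_eq0_normal => j k jT kT kj.
have fj := face_is_face jT.
have kf : k \in (cell T :\ j)%SET by rewrite !inE kj.
have avalq x : aval q x = \sum_(l in cell T) dof l *: aval (rtphi (cell T :\ l)%SET T) x.
  rewrite /q; elim/big_rec2: _ => [|l y1 y2 _ <-].
    by rewrite /aval mulmx0 addr0.
  exact: aval_lin.
rewrite aval_lin avalq scaleN1r dotvDl dotvNl dotv_suml (bigD1 j) //=.
rewrite big1 ?addr0 => [|l /andP[lT lj]]; last first.
  have lf : l \in (cell T :\ j)%SET by rewrite !inE lj.
  by rewrite dotvZl aval_rtphi // dotvZl nrm_orth // !mulr0.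
rewrite dotvZl aval_rtphi // dotvZl.
have hE : dotv (nd k - nd j) (nrm (cell T :\ j)%SET) = height T (cell T :\ j)%SET.
  rewrite height_face // !dotvBl; congr (_ - _); apply/esym/eqP.
  by rewrite -subr_eq0 -dotvBl dotv_face.
rewrite hE mulVf ?height_neq0 // mulr1 /dof -dotvNl -dotvDl /aval.
rewrite opprD addrACA addNr addr0 -mulNmx -mulmxDl pb mul_mx_scalar dotvZl.
by rewrite addrC -opprB dotvNl dotv_face // oppr0 mulr0.
Qed.

Lemma adiv_RT (p : affine R d) (b : R) : p.1 = b%:M ->
  adiv p = \sum_(j in cell T)
    dotv (aval p (bary nd (cell T :\ j)%SET)) (nrm (cell T :\ j)%SET)
    * adiv (rtphi (cell T :\ j)%SET T).
Proof.
move=> pb; rewrite {1}(RT_interp pb).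
elim/big_rec2: _ => [|j y1 y2 _ <-]; last exact: adiv_lin.
by rewrite /adiv mxtrace0.
Qed.

End CellBounds.

(** * The forms of the two schemes *)

Section CommonForms.
Variables (R : realType) (d : nat) (G : geometry R d) (M : mesh G).
Hypothesis d0 : (0 < d)%N.
Local Notation V := 'rV[R]_d.

Section OneSide.
Variable i : side.
Local Notation W := (pwP1 M i).

Lemma linform_dot_aval (T : 'I_(nc M i)) (x w : V) :
  linform (fun u : W => dotv (aval (u T) x) w).
Proof. by move=> c u v; rewrite pw_lin aval_lin dotvDl dotvZl. Qed.

Lemma linform_aval_coord (T : 'I_(nc M i)) (x : V) l :
  linform (fun u : W => aval (u T) x 0 l).
Proof. by move=> c u v; rewrite pw_lin aval_lin !mxE. Qed.

Definition mass_form (u v : W) : R :=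
  \sum_T tint T (fun x => dotv (aval (u T) x) (aval (v T) x)).

Lemma sbilin_mass : sbilin mass_form.
Proof.
apply: sbilin_sum => T _.
apply: (@sbilin_sint _ W _ _ _ _ _
  (fun u v x => dotv (aval (u T) x) (aval (v T) x))) => [|u v|x].
- exact: cell_pos.
- exact: quadratic_dotv.
- by apply: sbilin_sum => l _; apply: sbilin_prod; exact: linform_aval_coord.
Qed.

Lemma mass_ge0 v : 0 <= mass_form v v.
Proof. by apply: sumr_ge0 => T _; apply: sint_ge0 => x; exact: dotv_ge0. Qed.

Lemma l2norm_div_le_mass : exists2 C : R, 0 <= C & forall v : W,
  l2norm (pwdiv v) ^+ 2 <= C * mass_form v v.
Proof.
have ex (T : 'I_(nc M i)) : exists C : R, 0 <= C /\ forall p : affine R d,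
    adiv p ^+ 2 * tmeas T <= C * tint T (fun x => dotv (aval p x) (aval p x)).
  by have [C C0 hC] := @div_le_mass R d G M i T; exists C.
have [C hC] := choice ex.
exists (\sum_T C T) => [|v]; first by apply: sumr_ge0 => T _; case: (hC T).
rewrite l2norm_div /mass_form mulr_sumr; apply: ler_sum => T _.
have [C0 hT] := hC T; apply: le_trans (hT _) _; rewrite ler_wpM2r //.
  by apply: sint_ge0 => x; exact: dotv_ge0.
by rewrite (bigD1 T) //= lerDl sumr_ge0 // => T' _; case: (hC T').
Qed.

Lemma jump_lin (c : R) (u v : W) e x :
  jump (c *: u + v) e x = c *: jump u e x + jump v e x.
Proof.
rewrite /jump; case: ifP => _; rewrite scaler_sumr -big_split.
  by apply: eq_bigr => T _; rewrite pw_lin aval_lin.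
apply: eq_bigr => T _; rewrite pw_lin aval_lin scalerDr !scalerA.
by rewrite (mulrC c).
Qed.

(** As an affine field the jump is covered by the quadrature rule, and so are
    products of jumps. *)
Lemma jump_affine (v : W) e : exists p : affine R d, jump v e = aval p.
Proof.
have avals (P : pred 'I_(nc M i)) (c : 'I_(nc M i) -> R) x :
    aval (\sum_(T | P T) c T *: v T : affine R d) x
    = \sum_(T | P T) c T *: aval (v T) x.
  elim/big_rec2: _ => [|T y1 y2 _ <-]; first by rewrite /aval mulmx0 addr0.
  exact: aval_lin.
have [e1|e1] := boolP (#|adj e : pred 'I_(nc M i)| == 1)%N.
  exists (\sum_(T | adj e T) 1 *: v T); apply/funext => x; rewrite avals /jump e1.
  by under [RHS]eq_bigr do rewrite scale1r.
exists (\sum_(T | adj e T) Num.sg (height T e) *: v T).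
by apply/funext => x; rewrite avals /jump (negPf e1).
Qed.

Lemma linear_set_mean_jump0 X : linear_set [set v : W | mean_jump0 v X].
Proof.
split=> [e eX j|c u v u0 v0 e eX j].
  rewrite /eint (_ : (fun x => jump 0 e x 0 j) = fun=> 0).
    by rewrite sint_cst ?mul0r // (face_card d0 eX).
  apply/funext => x; have := jump_lin (-1) (0 : W) 0 e x.
  by rewrite scaler0 add0r scaleN1r addNr => ->; rewrite mxE.
transitivity (c * eint e (fun x => jump u e x 0 j) + eint e (fun x => jump v e x 0 j));
  last by rewrite u0 // v0 // mulr0 addr0.
rewrite /eint -(sint_lin _ (face_card d0 eX)).
- by congr (sint _ _ _); apply/funext => x; rewrite jump_lin !mxE.
- by have [p ->] := jump_affine u e; exact/quadratic_affine/scalar_affine_coord.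
- by have [p ->] := jump_affine v e; exact/quadratic_affine/scalar_affine_coord.
Qed.

Lemma linear_set_mean_njump0 X : linear_set [set v : W | mean_njump0 v X].
Proof.
split=> [e eX|c u v u0 v0 e eX].
  rewrite /eint (_ : (fun x => dotv (jump 0 e x) _) = fun=> 0).
    by rewrite sint_cst ?mul0r // (face_card d0 eX).
  apply/funext => x; have := jump_lin (-1) (0 : W) 0 e x.
  by rewrite scaler0 add0r scaleN1r addNr => ->; rewrite dotv0l.
transitivity (c * eint e (fun x => dotv (jump u e x) (nrm e))
    + eint e (fun x => dotv (jump v e x) (nrm e)));
  last by rewrite u0 // v0 // mulr0 addr0.
rewrite /eint -(sint_lin _ (face_card d0 eX)).
- by congr (sint _ _ _); apply/funext => x; rewrite jump_lin dotvDl dotvZl.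
- by have [p ->] := jump_affine u e; exact/quadratic_affine/scalar_affine_dot.
- by have [p ->] := jump_affine v e; exact/quadratic_affine/scalar_affine_dot.
Qed.

Lemma linear_setI (U : lmodType R) (A B : set U) :
  linear_set A -> linear_set B -> linear_set [set v | A v /\ B v].
Proof.
move=> [A0 hA] [B0 hB]; split=> // c u v [Au Bu] [Av Bv].
by split; [exact: hA|exact: hB].
Qed.

Lemma diam_ge0 (X : set V) : 0 <= diam X.
Proof.
have [hs|hs] := pselect (has_sup [set enorm (p.1 - p.2) | p in (X `*` X)%classic]).
  have [y [p Xp _]] := hs.1; apply: (@le_trans _ _ (enorm (p.1 - p.2))).
    exact: sqrtr_ge0.
  by apply: (sup_upper_bound hs); exists p.
by rewrite /diam sup_out.
Qed.

End OneSide.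

Lemma sbilin_eps : sbilin (@eps_eps _ _ _ M).
Proof.
apply: sbilin_sum => T _.
apply: (@sbilin_sint _ (pwP1 M Stokes) _ _ _ _ _
  (fun u v _ => ddot (aeps (u T)) (aeps (v T)))) => [|u v|x].
- exact: cell_pos.
- exact: quadratic_cst.
apply: sbilin_sum => j _; apply: sbilin_sum => k _; apply: sbilin_prod => c u v.
by rewrite pw_lin aeps_lin !mxE.
Qed.

Lemma eps_eps_ge0 (v : pwP1 M Stokes) : 0 <= eps_eps v v.
Proof.
by apply: sumr_ge0 => T _; rewrite tint_cst mulr_ge0 ?ddot_ge0 ?tmeas_ge0.
Qed.

Lemma l2norm_div_le_eps (v : pwP1 M Stokes) :
  l2norm (pwdiv v) ^+ 2 <= d%:R * eps_eps v v.
Proof.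
rewrite l2norm_div mulr_sumr; apply: ler_sum => T _.
by rewrite tint_cst mulrA ler_wpM2r ?tmeas_ge0 // adiv_sqr_aeps.
Qed.

Lemma sbilin_tang : sbilin (@tang_gamma _ _ _ M).
Proof.
apply: sbilin_sum => e eG; apply: sbilin_sum => T _.
apply: (@sbilin_sint _ (pwP1 M Stokes) _ _ _ _ _
  (fun u v x => \sum_(k < d.-1) dotv (aval (u T) x) (row k (tang e)) *
                    dotv (aval (v T) x) (row k (tang e)))) => [|u v|x].
- exact: face_card eG.
- by apply: quadratic_sum => k; apply: quadratic_prod; exact: scalar_affine_dot.
- by apply: sbilin_sum => k _; apply: sbilin_prod; exact: linform_dot_aval.
Qed.

Lemma tang_ge0 (v : pwP1 M Stokes) : 0 <= tang_gamma v v.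
Proof.
apply: sumr_ge0 => e _; apply: sumr_ge0 => T _; apply: sint_ge0 => x.
by apply: sumr_ge0 => k _; rewrite -expr2 sqr_ge0.
Qed.

End CommonForms.

Section NonconformingScheme.
Variables (R : realType) (d : nat) (G : geometry R d) (M : mesh G).
Hypothesis d0 : (0 < d)%N.
Local Notation D := (nonconf_disc M).

Lemma hface_inv_ge0 (e : {set 'I_(nv M)}) : 0 <= (hface e)^-1.
Proof. by rewrite invr_ge0; exact: diam_ge0. Qed.

Lemma sbilin_nonconf_aS (bt : R) : @sbilin R (pwP1 M Stokes) (@aS _ _ _ _ D bt).
Proof.
apply: sbilin_add; first apply: sbilin_add; try apply: sbilin_scale.
- exact: sbilin_eps.
- exact: sbilin_tang.
apply: sbilin_sum => e eX.
apply: (@sbilin_sint _ (pwP1 M Stokes) _ _ _ _ _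
  (fun u v x => (hface e)^-1 * dotv (jump u e x) (jump v e x))) => [|u v|x].
- exact: face_card eX.
- have [p ->] := jump_affine u e; have [q ->] := jump_affine v e.
  exact/quadratic_scale/quadratic_dotv.
- apply: sbilin_scale; apply: sbilin_sum => l _; apply: sbilin_prod => c u v.
  by rewrite jump_lin !mxE.
Qed.

Lemma sbilin_nonconf_aD : @sbilin R (pwP1 M Darcy) (@aD _ _ _ _ D).
Proof.
apply: sbilin_add; first exact: sbilin_mass.
apply: sbilin_sum => e eX.
apply: (@sbilin_sint _ (pwP1 M Darcy) _ _ _ _ _
  (fun u v x => (hface e)^-1 * (dotv (jump u e x) (nrm e) * dotv (jump v e x) (nrm e))))
  => [|u v|x].
- exact: face_card eX.
- have [p ->] := jump_affine u e; have [q ->] := jump_affine v e.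
  by apply/quadratic_scale/quadratic_prod; exact: scalar_affine_dot.
- apply: sbilin_scale; apply: sbilin_prod => c u v.
  by rewrite jump_lin dotvDl dotvZl.
Qed.

Lemma nonconf_aS_ge (bt : R) (v : pwP1 M Stokes) : 0 < bt ->
  eps_eps v v <= @aS _ _ _ _ D bt v v.
Proof.
move=> bt0; have e0 := eps_eps_ge0 v.
have t0 : 0 <= bt * tang_gamma v v by rewrite mulr_ge0 ?tang_ge0 // ltW.
rewrite /= -addrA -[X in X <= _]addr0 lerD //; first by lra.
rewrite addr_ge0 //; apply: sumr_ge0 => e _; apply: sint_ge0 => x.
by rewrite mulr_ge0 ?hface_inv_ge0 ?dotv_ge0.
Qed.

Lemma nonconf_aD_ge (v : pwP1 M Darcy) : mass_form v v <= @aD _ _ _ _ D v v.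
Proof.
rewrite /= lerDl; apply: sumr_ge0 => e _; apply: sint_ge0 => x.
by rewrite mulr_ge0 ?hface_inv_ge0 // -expr2 sqr_ge0.
Qed.

End NonconformingScheme.

Section HdivScheme.
Import numFieldNormedType.Exports.
Variables (R : realType) (d : nat) (G : geometry R d) (M : mesh G).
Hypothesis d0 : (0 < d)%N.
Local Notation V := 'rV[R]_d.
Local Notation nd := (@node _ _ _ M).

Section RaviartThomas.
Variable i : side.
Local Notation W := (pwP1 M i).

Lemma linear_set_RT0 : linear_set [set v : W | RT0 v].
Proof.
split=> [|c u v [u1 u2 u3] [v1 v2 v3]]; split.
- by move=> T; exists 0; rewrite ffunE; apply/matrixP => j k; rewrite !mxE mul0rn.
- by move=> e T T' x _ _ _ _; rewrite !ffunE.
- by move=> e T x _ _ _; rewrite ffunE /aval mulmx0 addr0 dotv0l.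
- move=> T; have [b ub] := u1 T; have [b' vb] := v1 T; exists (c * b + b').
  by rewrite pw_lin /= ub vb scale_scalar_mx raddfD.
- move=> e T T' x eX eT eT' hx.
  rewrite [LHS](linform_dot_aval T) [RHS](linform_dot_aval T') /=.
  by rewrite (u2 e T T' x eX eT eT' hx) (v2 e T T' x eX eT eT' hx).
- move=> e T x eX eT hx.
  by rewrite pw_lin aval_lin dotvDl dotvZl (u3 e) // (v3 e) // mulr0 addr0.
Qed.

Lemma linform_rtdof e : linform (fun v : W => rtdof v e).
Proof.
move=> c u v; rewrite /rtdof; case: pickP => [T _|_]; last by rewrite mulr0 addr0.
exact: linform_dot_aval.
Qed.

(** The cell chosen in the definition of a degree of freedom is immaterial:
    two cells that meet in a face have it in the interior of the subdomain,
    where normal components agree. *)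
Lemma rtdofE (v : W) (T : 'I_(nc M i)) (e : {set 'I_(nv M)}) : RT0 v -> #|e| = d -> adj e T ->
  rtdof v e = dotv (aval (v T) (bary nd e)) (nrm e).
Proof.
move=> [_ v2 _] ce eT; rewrite /rtdof; case: pickP => [T' eT'|/(_ T)]; last by rewrite eT.
have [->//|TT'] := eqVneq T' T.
apply: v2 => //; first exact: (shared_face_interior d0 ce eT' eT TT').
by apply: (relint_subset_hull (fintype.subxx e)); apply: bary_relint; rewrite ce.
Qed.

Lemma face_in_closure (T : 'I_(nc M i)) (e : {set 'I_(nv M)}) : #|e| = d ->
  e \subset cell T -> e \in Eh M (closure (Om G i)).
Proof.
move=> ce eT; rewrite inE; apply/asboolP; split; first by split=> //; exists i, T.
exact: subset_trans (relint_subset_hull eT) (@hull_subset_closure _ _ _ _ _ T).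
Qed.

(** Faces outside the cell contribute nothing, since the basis functions attached
    to them vanish on it; the sum thus has the range of the stabilisation. *)
Lemma adiv_rtdof (v : W) (T : 'I_(nc M i)) : RT0 v ->
  adiv (v T) = \sum_(e : {set 'I_(nv M)} | e \in Eh M (closure (Om G i))) rtdof v e * adiv (rtphi e T).
Proof.
move=> RTv; have [b vb] := (let: And3 h _ _ := RTv in h T).
rewrite (adiv_RT d0 T vb) (bigID (fun e : {set 'I_(nv M)} => e \subset cell T)) /=.
rewrite [X in _ = _ + X]big1 ?addr0; last first.
  move=> e /andP[_ /negPf eT]; rewrite /rtphi /adj eT /adiv mxtrace0.
  by rewrite mulr0.
rewrite (eq_bigl (mem [set (cell T :\ j)%SET | j in cell T])); last first.
  move=> e; apply/andP/imsetP => [[]|[j jT ->]].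
    rewrite inE => /asboolP[[ce _] _] eT; have [j jT ->] := face_opposite ce eT.
    by exists j.
  by rewrite (@face_in_closure T) ?subD1set ?card_face.
rewrite big_imset /=; last first.
  move=> j k jT kT /setP /(_ j); rewrite !inE eqxx jT andbT /=.
  by case: eqP.
apply: eq_bigr => j jT; rewrite (rtdofE (T := T)) ?card_face //.
by rewrite /adj subD1set.
Qed.

End RaviartThomas.

Lemma linear_set_contP1 : linear_set [set v : pwP1 M Stokes | @contP1 _ _ _ M v].
Proof.
split=> [|c u v [u1 u2] [v1 v2]]; split.
- by move=> T T' x _ _; rewrite !ffunE.
- by move=> T x _ _; rewrite ffunE /aval mulmx0 addr0.
- move=> T T' x hx hx'; rewrite !pw_lin !aval_lin.
  by rewrite (u1 T T' x) // (v1 T T' x).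
- by move=> T x hx gx; rewrite pw_lin aval_lin u2 // v2 // scaler0 addr0.
Qed.

Variables (alphaT : 'I_(nc M Stokes) -> R) (gam : R).
Hypothesis alphaT0 : forall T, 0 < alphaT T.
Local Notation W2 := (VtA M).

Lemma linear_set_VSA : @linear_set R (pwP1 M Stokes * pwP1 M Stokes)%type (@VSA _ _ _ M).
Proof.
have [c0 hc] := linear_set_contP1; have [r0 hr] := linear_set_RT0 Stokes.
split=> [|c u v [u1 u2] [v1 v2]]; split=> //=.
- exact: hc.
- exact: hr.
Qed.

Lemma sbilin_rt_stab : @sbilin R (pwP1 M Stokes) (rt_stab alphaT).
Proof.
apply: sbilin_sum => T _; apply: sbilin_sum => e _.
rewrite (_ : (fun u v => _) = fun u v : pwP1 M Stokes =>
  (alphaT T * tint T (fun=> adiv (rtphi e T) * adiv (rtphi e T)))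
   * (rtdof u e * rtdof v e)).
  by apply: sbilin_scale; apply: sbilin_prod; exact: linform_rtdof.
by apply/funext => u; apply/funext => v; ring.
Qed.

Lemma rt_stab_term_ge0 (v : pwP1 M Stokes) (T : 'I_(nc M Stokes))
    (e : {set 'I_(nv M)}) :
  0 <= alphaT T * rtdof v e * rtdof v e
       * tint T (fun=> adiv (rtphi e T) * adiv (rtphi e T)).
Proof.
rewrite tint_cst -[X in X * _]mulrA -!expr2 mulr_ge0 //.
  by rewrite mulr_ge0 ?sqr_ge0 // ltW.
by rewrite mulr_ge0 ?sqr_ge0 ?tmeas_ge0.
Qed.

Lemma rt_stab_ge0 v : 0 <= rt_stab alphaT v v.
Proof.
apply: sumr_ge0 => T _; apply: sumr_ge0 => e _.
exact: rt_stab_term_ge0.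
Qed.

Lemma quadratic_trace (T : 'I_(nc M Stokes)) (p q : affine R d) (e : {set 'I_(nv M)}) :
  quadratic (fun x => dotv (aval p x) (nout T e) * dotv (aval q x) (nout T e)).
Proof. by apply: quadratic_prod; exact: scalar_affine_dot. Qed.

Lemma sbilin_normal : @sbilin R (pwP1 M Stokes) (@normal_gamma _ _ _ M).
Proof.
apply: sbilin_sum => e eG; apply: sbilin_sum => T _.
apply: (@sbilin_sint _ (pwP1 M Stokes) _ _ _ _ _
  (fun u v x => dotv (aval (u T) x) (nout T e) * dotv (aval (v T) x) (nout T e)))
  => [|u v|x].
- exact: face_card eG.
- exact: quadratic_trace.
- by apply: sbilin_prod; exact: linform_dot_aval.
Qed.

Lemma normal_ge0 (v : pwP1 M Stokes) : 0 <= normal_gamma v v.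
Proof.
apply: sumr_ge0 => e _; apply: sumr_ge0 => T _; apply: sint_ge0 => x.
by rewrite -expr2 sqr_ge0.
Qed.

Lemma quadratic_cross (T : 'I_(nc M Stokes)) (p q : affine R d) (e : {set 'I_(nv M)}) :
  quadratic (fun x => dotv (nout T e *m aeps p) (nout T e) * dotv (aval q x) (nout T e)).
Proof. exact/quadratic_scale/quadratic_affine/scalar_affine_dot. Qed.

Lemma linform_cross_l (w : pwP1 M Stokes) :
  linform (fun u : pwP1 M Stokes => cross_gamma u w).
Proof.
apply: linform_sum => e eG; apply: linform_sum => T _.
apply: (@linform_sint _ (pwP1 M Stokes) _ _ _ _ _ (fun u x =>
  dotv (nout T e *m aeps (u T)) (nout T e) * dotv (aval (w T) x) (nout T e)))
  => [|u|x].
- exact: face_card eG.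
- exact: quadratic_cross.
- apply: linform_scaler => c u v; rewrite pw_lin aeps_lin mulmxDr -scalemxAr.
  by rewrite dotvDl dotvZl.
Qed.

Lemma linform_cross_r (u : pwP1 M Stokes) :
  linform (fun w : pwP1 M Stokes => cross_gamma u w).
Proof.
apply: linform_sum => e eG; apply: linform_sum => T _.
apply: (@linform_sint _ (pwP1 M Stokes) _ _ _ _ _ (fun w x =>
  dotv (nout T e *m aeps (u T)) (nout T e) * dotv (aval (w T) x) (nout T e)))
  => [|w|x].
- exact: face_card eG.
- exact: quadratic_cross.
- by apply: linform_scale; exact: linform_dot_aval.
Qed.

Lemma sbilin_aSA (bt : R) :
  @sbilin R (pwP1 M Stokes * pwP1 M Stokes)%type (aSA alphaT gam bt).
Proof.
pose W' := (pwP1 M Stokes * pwP1 M Stokes)%type.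
rewrite (_ : aSA _ _ _ = fun u v : W' =>
  2 * eps_eps u.1 v.1 + bt * tang_gamma u.1 v.1 + 2 * rt_stab alphaT u.2 v.2
  + 2 * (cross_gamma u.1 v.2 + cross_gamma v.1 u.2)
  + gam / hmax M * normal_gamma u.2 v.2); last first.
  by apply/funext => u; apply/funext => v; rewrite /aSA; ring.
apply: sbilin_add; last first.
  exact/sbilin_scale/(@sbilin_comp _ W' (pwP1 M Stokes) snd)/sbilin_normal.
apply: sbilin_add; last first.
  apply/sbilin_scale/(@sbilin_swap _ W' (fun u v => cross_gamma u.1 v.2)) => w c u v.
    exact: linform_cross_l.
  exact: linform_cross_r.
apply: sbilin_add; last first.
  exact/sbilin_scale/(@sbilin_comp _ W' (pwP1 M Stokes) snd)/sbilin_rt_stab.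
apply: sbilin_add; apply/sbilin_scale.
  exact/(@sbilin_comp _ W' (pwP1 M Stokes) fst)/sbilin_eps.
exact/(@sbilin_comp _ W' (pwP1 M Stokes) fst)/sbilin_tang.
Qed.

Lemma hmax_ge0 : 0 <= hmax M.
Proof.
rewrite /hmax; elim/big_rec: _ => // i x _ x0.
by rewrite le_max x0 orbT.
Qed.

Lemma energyA_ge (bt : R) (v : W2) : 0 < bt ->
  eps_eps v.1 v.1 + rt_stab alphaT v.2 v.2 <= energyA alphaT bt v.
Proof.
move=> bt0; rewrite /energyA.
have t0 : 0 <= bt * tang_gamma v.1 v.1 by rewrite mulr_ge0 ?tang_ge0 // ltW.
have n0 : 0 <= (hmax M)^-1 * normal_gamma v.2 v.2.
  by rewrite mulr_ge0 ?normal_ge0 // invr_ge0 hmax_ge0.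
lra.
Qed.

Lemma RT_div_le_stab : exists2 C : R, 0 <= C & forall v : pwP1 M Stokes, RT0 v ->
  l2norm (pwdiv v) ^+ 2 <= C * rt_stab alphaT v v.
Proof.
pose n : R := #|Eh M (closure (Om G Stokes))|%:R.
have al0 T : 0 <= (alphaT T)^-1 by rewrite invr_ge0 ltW.
exists (n * \sum_T (alphaT T)^-1) => [|v RTv].
  by rewrite mulr_ge0 ?ler0n // sumr_ge0.
rewrite l2norm_div mulr_sumr; apply: ler_sum => T _.
set S := \sum_(e in _) _.
have S0 : 0 <= S.
  by apply: sumr_ge0 => e _; exact: rt_stab_term_ge0.
apply: (@le_trans _ _ (n * (alphaT T)^-1 * S)); last first.
  rewrite ler_wpM2r // ler_wpM2l ?ler0n // (bigD1 T) //= lerDl.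
  by rewrite sumr_ge0.
rewrite (adiv_rtdof T RTv) -[X in _ <= X]mulrA.
apply: (@le_trans _ _ (n * (\sum_(e : {set 'I_(nv M)} | e \in Eh M (closure (Om G Stokes)))
    (rtdof v e * adiv (rtphi e T)) ^+ 2) * tmeas T)).
  by rewrite ler_wpM2r ?tmeas_ge0 // sqr_sum_le.
rewrite -mulrA ler_wpM2l ?ler0n // /S mulr_sumr mulr_suml; apply: ler_sum => e _.
rewrite tint_cst le_eqVlt; apply/orP; left; apply/eqP.
by field; rewrite gt_eqF.
Qed.

(** The energy norm of the coercivity assumption contains the symmetric gradient
    of the continuous part and the stabilisation of the Raviart-Thomas part; its
    constant serves all tangential coefficients at once. *)
Lemma hdiv_aS_div : coerciveA alphaT gam -> exists2 C : R, 0 <= C &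
  forall (bt : R) (v : W2), 0 < bt -> VSA v ->
  l2norm (pwdiv (v.1 + v.2)) ^+ 2 <= C * aSA alphaT gam bt v v.
Proof.
move=> [c c0 hc]; have [C C0 hC] := RT_div_le_stab.
pose C1 : R := 2 * (d%:R + C); have C10 : 0 <= C1 by rewrite mulr_ge0 // addr_ge0 ?ler0n.
exists (C1 / c) => [|bt v bt0 Vv]; first by rewrite divr_ge0 // ltW.
apply: (@le_trans _ _ (C1 / c * (c * energyA alphaT bt v))); last first.
  by rewrite ler_wpM2l ?hc // divr_ge0 // ltW.
rewrite mulrA mulfVK ?gt_eqF //.
apply: le_trans (ler_wpM2l C10 (energyA_ge v bt0)).
have e0 := eps_eps_ge0 v.1; have s0 := rt_stab_ge0 v.2.
have [_ RTv] := Vv.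
have h1 := l2norm_div_le_eps v.1; have h2 := hC _ RTv.
have h3 : l2norm (pwdiv (v.1 + v.2)) ^+ 2
    <= 2 * l2norm (pwdiv v.1) ^+ 2 + 2 * l2norm (pwdiv v.2) ^+ 2.
  rewrite !l2norm_div !mulr_sumr -big_split; apply: ler_sum => T _.
  rewrite (_ : (v.1 + v.2) T = 1 *: v.1 T + v.2 T); last by rewrite ffunE scale1r.
  rewrite adiv_lin mul1r [leRHS]/=.
  move: (adiv _) (adiv _) (tmeas T) (tmeas_ge0 T) => x y m m0.
  have h : (x + y) ^+ 2 <= 2 * x ^+ 2 + 2 * y ^+ 2 by have := sqr_ge0 (x - y); nra.
  by have := ler_wpM2r m0 h; lra.
apply: (le_trans h3).
have m1 : 0 <= d%:R * rt_stab alphaT v.2 v.2 by rewrite mulr_ge0 ?ler0n.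
have m2 : 0 <= C * eps_eps v.1 v.1 by rewrite mulr_ge0.
rewrite /C1; lra.
Qed.

Lemma hdiv_aS_ge0 (bt : R) (v : W2) : coerciveA alphaT gam -> 0 < bt -> VSA v ->
  0 <= aSA alphaT gam bt v v.
Proof.
move=> [c c0 hc] bt0 Vv; apply: le_trans (hc bt v bt0 Vv).
rewrite mulr_ge0 ?(ltW c0) //; apply: le_trans (energyA_ge v bt0).
by rewrite addr_ge0 ?eps_eps_ge0 ?rt_stab_ge0.
Qed.

End HdivScheme.

(** * Uniformity in the viscosity and the conductivity *)

Section Family.
Variables (R : realType) (d : nat) (G : geometry R d).
Hypothesis d0 : (0 < d)%N.

Lemma scheme_infsup (I : Type) (M : I -> mesh G) (s : scheme M) (h : I)
    (alpha wS wD gS gD : R) :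
  scheme_ok s -> 0 < alpha -> 1 <= wS -> 1 <= wD -> 0 < gS -> 0 < gD ->
  exists2 g : R, 0 < g & forall mu K, 0 < mu -> 0 < K ->
  forall Y : set (Xt (disc s h)),
  (forall x, Y x -> [/\ Vh x.1, infsup_S (disc s h) gS (tbeta alpha mu K) x.2.1
                      & infsup_D (disc s h) gD x.2.2]) ->
  (forall x v, Y x -> Vh v -> Y (v, - x.2)) ->
  (g%:E <= infsup alpha wS wD mu K Y)%E.
Proof.
move=> hs al0 wS1 wD1 gS0 gD0.
have [CD CD0 hCD] := @l2norm_div_le_mass R d G (M h) Darcy.
have wS0 := le_trans ler01 wS1; have wD0 := le_trans ler01 wD1.
have gpos (C : R) : 0 <= C ->
    0 < (4 * (1 + (wS + wD) * C) + 2 * ((2 / gS) ^+ 2 + (2 / gD) ^+ 2))^-1.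
  move=> C0; rewrite invr_gt0 ltr_wpDl //.
    by rewrite mulr_ge0 // addr_ge0 // mulr_ge0 // addr_ge0.
  by rewrite mulr_gt0 // addr_gt0 // exprn_gt0 // divr_gt0.
case: s hs => [alphaT gam|] /= hs.
- have [alphaT0 gam0 hc] := hs.
  have [CS CS0 hCS] := hdiv_aS_div d0 (alphaT0 h) (hc h).
  exists (4 * (1 + (wS + wD) * (CS + CD)) + 2 * ((2 / gS) ^+ 2 + (2 / gD) ^+ 2))^-1.
    by apply: gpos; exact: addr_ge0.
  move=> mu K mu0 K0 Y hY NY.
  apply: (@infsup_ge R d G (M h) d0 (pwP1 (M h) Stokes * pwP1 (M h) Stokes)%type
    (fun v => v.1 + v.2) (@VSA _ _ _ (M h)) (aSA (@alphaT h) gam)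
    [set v | RT0 v]%classic (@mass_form _ _ _ _ Darcy) _ _ _ _ _ (CS + CD)
    _ _ _ _ _ alpha wS wD mu K al0 wS1 wD1 mu0 K0 gS gD Y gS0 gD0 hY NY).
  + by move=> c u v /=; rewrite scalerDr addrACA.
  + exact: linear_set_VSA.
  + exact: linear_set_RT0.
  + exact: sbilin_aSA.
  + exact: sbilin_mass.
  + exact: addr_ge0.
  + by move=> bt v; exact: hdiv_aS_ge0.
  + by move=> v _; exact: mass_ge0.
  + move=> bt v bt0 Vv; apply: le_trans (hCS bt v bt0 Vv) _.
    by rewrite ler_wpM2r ?lerDl // hdiv_aS_ge0.
  + move=> v _; apply: le_trans (hCD v) _.
    by rewrite ler_wpM2r ?lerDr ?mass_ge0.
- exists (4 * (1 + (wS + wD) * (d%:R + CD)) + 2 * ((2 / gS) ^+ 2 + (2 / gD) ^+ 2))^-1.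
    by apply: gpos; rewrite addr_ge0.
  move=> mu K mu0 K0 Y hY NY.
  have aS0 (bt : R) (v : pwP1 (M h) Stokes) : 0 < bt -> 0 <= @aS _ _ _ _ (nonconf_disc (M h)) bt v v.
    by move=> bt0; apply: le_trans (nonconf_aS_ge v bt0); exact: eps_eps_ge0.
  have aD0 (v : pwP1 (M h) Darcy) : 0 <= @aD _ _ _ _ (nonconf_disc (M h)) v v.
    by apply: le_trans (nonconf_aD_ge v); exact: mass_ge0.
  apply: (@infsup_ge R d G (M h) d0 (pwP1 (M h) Stokes) id
    (@VS _ _ _ _ (nonconf_disc (M h))) (@aS _ _ _ _ (nonconf_disc (M h)))
    (@VD _ _ _ _ (nonconf_disc (M h))) (@aD _ _ _ _ (nonconf_disc (M h)))
    _ _ _ _ _ (d%:R + CD) _ _ _ _ _ alpha wS wD mu K al0 wS1 wD1 mu0 K0 gS gD Y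
    gS0 gD0 hY NY).
  + by [].
  + by apply: linear_setI; exact: linear_set_mean_jump0.
  + by apply: linear_setI; [exact: linear_set_mean_jump0|exact: linear_set_mean_njump0].
  + exact: sbilin_nonconf_aS.
  + exact: sbilin_nonconf_aD.
  + by rewrite addr_ge0.
  + by move=> bt v bt0 _; exact: aS0.
  + by move=> v _; exact: aD0.
  + move=> bt v bt0 _; apply: le_trans (l2norm_div_le_eps v) _.
    apply: (@le_trans _ _ (d%:R * @aS _ _ _ _ (nonconf_disc (M h)) bt v v)).
      by rewrite ler_wpM2l ?nonconf_aS_ge.
    by rewrite ler_wpM2r ?lerDl ?aS0.
  + move=> v _; apply: le_trans (hCD v) _.
    apply: (@le_trans _ _ (CD * @aD _ _ _ _ (nonconf_disc (M h)) v v)).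
      by rewrite ler_wpM2l // nonconf_aD_ge.
    by rewrite ler_wpM2r ?lerDr.
Qed.

Lemma mean0N (M : mesh G) (i : side) (q : pwP0 M i) : mean0 q -> mean0 (- q).
Proof.
rewrite /mean0 => q0.
transitivity (- \sum_T tint T (fun=> q T)); last by rewrite q0 oppr0.
rewrite -sumrN; apply: eq_bigr => T _.
by rewrite !tint_cst ffunE mulNr.
Qed.

End Family.

Theorem lemma4p2 (R : realType) (d : nat) (hd : d = 2%N \/ d = 3%N)
    (G : geometry R d) (I : Type) (M : I -> mesh G)
    (s : scheme M) (hs : scheme_ok s)
    (alpha wS wD : R) (halpha : 0 < alpha) (hwS : 1 <= wS) (hwD : 1 <= wD)
    (AS : assumption_S s alpha) (AD : assumption_D s) :
  ((0 < surf (GN G Stokes))%E -> surf (GN G Darcy) = 0%E ->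
    forall h : I, exists2 g : R, 0 < g &
      forall mu K : R, 0 < mu -> 0 < K ->
        (g%:E <= infsup alpha wS wD mu K (X_RD (disc s h)))%E)
  /\
  (surf (GN G Stokes) = 0%E -> (0 < surf (GN G Darcy))%E ->
    forall h : I, exists2 g : R, 0 < g &
      forall mu K : R, 0 < mu -> 0 < K ->
        (g%:E <= infsup alpha wS wD mu K (X_RS (disc s h)))%E).
Proof.
have d0 : (0 < d)%N by case: hd => ->.
have [gS gS0 hS] := AS; have [gD gD0 hD] := AD.
split=> surfS surfD h.
- have [g g0 hg] := scheme_infsup d0 h hs halpha hwS hwD gS0 gD0.
  exists g => // mu K mu0 K0; apply: hg => // [x [Vx qx]|x v [Vx qx] Vv].
    split=> //; last by apply: hD.
    by apply: hS => // S0; rewrite S0 ltxx in surfS.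
  by split=> //; exact: mean0N.
- have [g g0 hg] := scheme_infsup d0 h hs halpha hwS hwD gS0 gD0.
  exists g => // mu K mu0 K0; apply: hg => // [x [Vx qx]|x v [Vx qx] Vv].
    split=> //; first by apply: hS.
    by apply: hD => D0; rewrite D0 ltxx in surfD.
  by split=> //; exact: mean0N.
Qed.
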